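(* Let $\alpha:M(T,X)\to\mathbb R$ be a continuous function. (1) Suppose that $(X,T)$ is transitively-convex-saturated and that $\alpha$ satisfies condition [A.3]. Then either $I_\alpha$ is empty or $$h_{top}(T,I_\alpha\cap Tran)=h_{top}(T,I_\alpha)=h_{top}(T).$$ (2) Suppose that $(X,T)$ is transitively-single-saturated. Then for any $a\in\mathbb R$, either $R_\alpha(a)$ is empty or $$h_{top}(T,R_\alpha(a)\cap Tran)=h_{top}(T,R_\alpha(a))=\sup\{h_\rho:\rho\in M(T,X)\text{ and }\alpha(\rho)=a\}.$$
   Context: $X$ is a compact metric space with metric $d$ and $T:X\to X$ is continuous. $M(T,X)$ is the set of $T$-invariant Borel probability measures with the weak$^*$ topology; $h_\mu=h_\mu(T)$ is the metric entropy. For $x\in X$, $\omega_T(x)$ is the $\omega$-limit set and $M_x$ is the set of weak$^*$ limit points of $\frac1n\sum_{j=0}^{n-1}\delta_{T^jx}$. $Tran=\{x:\omega_T(x)=X\}$. Topological entropy of $E\subseteq X$ (Bowen): let $B_n(x,\varepsilon)=\{y: d(T^jx,T^jy)\le\varepsilon,\ 0\le j\le n-1\}$; $\mathfrak F_n(E,\varepsilon)$ is the collection of finite or countable covers of $E$ by sets $B_m(x,\varepsilon)$ with $m\ge n$; $C(E;t,n,\varepsilon,T)=\inf\{\sum_{B_m(x,\varepsilon)\in\mathcal C}2^{-tm}:\mathcal C\in\mathfrak F_n(E,\varepsilon)\}$; $C(E;t,\varepsilon,T)=\lim_{n}C(E;t,n,\varepsilon,T)$; $h_{top}(E,\varepsilon,T)=\inf\{t\ge0:C(E;t,\varepsilon,T)=0\}$;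 $h_{top}(T,E)=\lim_{\varepsilon\to0}h_{top}(E,\varepsilon,T)$; $h_{top}(T)=h_{top}(T,X)$. Metric entropy uses the same logarithm base $2$. For $K\subseteq M(T,X)$ let $G^T_K=\{x\in Tran:M_x=K\}$, and consider $( * )$: $G^T_K\neq\emptyset$ and $h_{top}(T,G^T_K)=\inf\{h_\mu(T):\mu\in K\}$. $T$ is transitively-convex-saturated if $( * )$ holds for every nonempty compact connected $K$ contained in the convex hull of finitely many invariant measures; transitively-single-saturated if $( * )$ holds for every $K=\{\mu\}$, $\mu\in M(T,X)$. $I_\alpha=\{x:\inf_{\mu\in M_x}\alpha(\mu)<\sup_{\mu\in M_x}\alpha(\mu)\}$, $R_\alpha(a)=\{x:\inf_{\mu\in M_x}\alpha(\mu)=\sup_{\mu\in M_x}\alpha(\mu)=a\}$. Condition [A.3]: for any $\mu,\nu\in M(T,X)$ with $\alpha(\mu)\neq\alpha(\nu)$, the function $\theta\mapsto\alpha(\theta\mu+(1-\theta)\nu)$ is not constant over any (nondegenerate) subinterval of $[0,1]$. *)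

(* Defs.v *)
From HB Require Import structures.
From mathcomp Require Import all_boot all_order all_algebra.
From mathcomp Require Import all_classical all_reals all_analysis.
Import Order.TTheory GRing.Theory Num.Theory.
Import numFieldNormedType.Exports.

Set Implicit Arguments.
Unset Strict Implicit.
Unset Printing Implicit Defensive.

Local Open Scope classical_set_scope.
Local Open Scope ring_scope.

(* Measurable types are pointed in the library, so metric spaces carrying their
   Borel sigma-algebra have to be pointed (that is, nonempty) as well. *)
#[short(type="pmetricType")]
HB.structure Definition PointedMetric (R : numDomainType) :=
  {T of Metric R T & isPointed T}.

Section borel_probabilities.
Context {R : realType} (X : pmetricType R).

Definition borel : measurableType (@open X).-sigma :=
  g_sigma_algebraType (@open X).

(* A library measure is a function on all subsets, unconstrained on the
   non-measurable ones.  Requiring the value 0 there makes equality of bprob the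
   equality of measures: each Borel probability measure occurs exactly once. *)
Record bprob := BProb {
  bprob_val :> probability borel R ;
  bprob_null : forall A : set borel, ~ measurable A -> bprob_val A = 0%E }.

HB.instance Definition _ := gen_eqMixin bprob.
HB.instance Definition _ := gen_choiceMixin bprob.

(* The weak-* topology: the coarsest one for which mu |-> \int[mu]_x f x is
   continuous for every continuous f : X -> R. *)
Definition wstar_eval (mu : bprob) : {ptws continuousType X R -> R} :=
  fun f => \int[mu]_x f x.

HB.instance Definition _ := Topological.copy bprob (initial_topology wstar_eval).

End borel_probabilities.

Section borel_restriction.
Context {R : realType} {X : pmetricType R}.
Variable mu : probability (borel X) R.

Definition brestr (A : set (borel X)) : \bar R :=
  if `[< measurable A >] then mu A else 0%E.

Lemma brestrE A : measurable A -> brestr A = mu A.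
Proof. by move=> mA; rewrite /brestr asboolT. Qed.

Let brestr0 : brestr set0 = 0%E.
Proof. by rewrite brestrE// measure0. Qed.

Let brestr_ge0 A : (0 <= brestr A)%E.
Proof. by rewrite /brestr; case: ifP. Qed.

Let brestr_sigma_additive : semi_sigma_additive brestr.
Proof.
move=> F mF tF mUF; rewrite brestrE//.
rewrite (_ : (fun n => _) = (fun n => \sum_(0 <= i < n) mu (F i))%E).
  exact: measure_semi_sigma_additive.
by apply/funext => n; apply: eq_bigr => i _; rewrite brestrE.
Qed.

HB.instance Definition _ := isMeasure.Build _ _ _ brestr
  brestr0 brestr_ge0 brestr_sigma_additive.

Let brestr_setT : brestr setT = 1%E.
Proof. by rewrite brestrE// probability_setT. Qed.

HB.instance Definition _ := Measure_isProbability.Build _ _ _ brestr brestr_setT.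

Let brestr_null A : ~ measurable A -> brestr A = 0%E.
Proof. by move=> nmA; rewrite /brestr asboolF. Qed.

Definition bprob_of : bprob X := BProb brestr_null.

End borel_restriction.

Section mixture.
Context {R : realType} {X : pmetricType R}.
Variables (t : {i01 R}) (mu nu : bprob X).

Definition mix_fun : set (borel X) -> \bar R :=
  measure_add (mscale (t%:num)%:nng mu) (mscale (1 - t%:num)%:nng nu).

HB.instance Definition _ := Measure.on mix_fun.

Let mix_setT : mix_fun setT = 1%E.
Proof.
rewrite /mix_fun measure_addE /mscale/=.
rewrite [X in (_ * X + _)%E]probability_setT [X in (_ + _ * X)%E]probability_setT.
by rewrite !mule1 -EFinD addrC subrK.
Qed.

HB.instance Definition _ := Measure_isProbability.Build _ _ _ mix_fun mix_setT.

(* t mu + (1 - t) nu *)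
Definition mix : bprob X := bprob_of mix_fun.

End mixture.

Section empirical.
Context {R : realType} {X : pmetricType R}.
Variables (T : X -> X) (x : X) (n : nat).

Definition emp_fun : set (borel X) -> \bar R :=
  mscale (n.+1%:R^-1 : R)%:nng
    (msum (fun j => dirac (iter j T x : borel X)) n.+1).

HB.instance Definition _ := Measure.on emp_fun.

Let emp_setT : emp_fun setT = 1%E.
Proof.
rewrite /emp_fun /mscale/= /msum/=.
rewrite (eq_bigr (fun=> 1%:E)); last by move=> i _; rewrite diracT.
by rewrite sumEFin -EFinM sumr_const card_ord mulVf// pnatr_eq0.
Qed.

HB.instance Definition _ := Measure_isProbability.Build _ _ _ emp_fun emp_setT.

(* the average of the Dirac masses at the first n.+1 points of the orbit of x *)
Definition empirical : bprob X := bprob_of emp_fun.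

End empirical.

Section dynamics.
Context {R : realType} {X : pmetricType R}.
Variable T : X -> X.

Definition invariant_measures : set (bprob X) :=
  [set mu | forall A : set (borel X), measurable A -> mu (T @^-1` A) = mu A].

Definition omega_limit (x : X) : set X := cluster (iter n T x @[n --> \oo]).

Definition Tran : set X := [set x | omega_limit x = setT].

Definition Mlim (x : X) : set (bprob X) :=
  cluster (empirical T x n @[n --> \oo]).

End dynamics.

Section topological_entropy.
Context {R : realType} {X : pmetricType R}.
Variable T : X -> X.
Local Open Scope ereal_scope.

Definition bowen_ball (n : nat) (x : X) (e : R) : set X :=
  [set y | forall j, (j < n)%N -> (mdist (iter j T x) (iter j T y) <= e)%R].

(* A cover by Bowen balls is encoded by the set of pairs (x, m) of its members
   B_m(x, e), the length m being part of the data of a member. *)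
Definition bowen_covers (E : set X) (n : nat) (e : R) : set (set (X * nat)) :=
  [set C | [/\ countable C, forall p, C p -> (n <= p.2)%N &
               E `<=` \bigcup_(p in C) bowen_ball p.2 p.1 e]].

Definition bowen_Cn (E : set X) (t : R) (n : nat) (e : R) : \bar R :=
  ereal_inf [set \esum_(p in C) (2 `^ (- (t * p.2%:R)))%:E
            | C in bowen_covers E n e].

Definition bowen_C (E : set X) (t e : R) : \bar R :=
  limn (fun n => bowen_Cn E t n e).

Definition htop_at (E : set X) (e : R) : \bar R :=
  ereal_inf [set t%:E | t in [set t : R | (0 <= t)%R /\ bowen_C E t e = 0]].

Definition htop (E : set X) : \bar R := lim (htop_at E e @[e --> 0^'+]).

End topological_entropy.

Section metric_entropy.
Context {R : realType} {X : pmetricType R}.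
Variables (T : X -> X) (mu : bprob X).

Definition log2 (x : R) : R := ln x / ln 2.

Definition is_partition (k : nat) (P : 'I_k -> set (borel X)) : Prop :=
  [/\ forall i, measurable (P i), trivIset setT P & \bigcup_i P i = setT].

(* Entropy of the join of P, T^-1 P, ..., T^-(n-1) P, whose cells are indexed by
   the words w of length n (0 * log2 0 = 0 takes care of the empty cells). *)
Definition join_entropy (k : nat) (P : 'I_k -> set (borel X)) (n : nat) : R :=
  - \sum_(w : {ffun 'I_n -> 'I_k})
      let p := fine (mu (\bigcap_(i : 'I_n) (iter i T @^-1` P (w i)))) in
      p * log2 p.

Definition partition_entropy (k : nat) (P : 'I_k -> set (borel X)) : R :=
  limn (fun n => join_entropy P n / n%:R).

Definition metric_entropy : \bar R :=
  ereal_sup [set h | exists k (P : 'I_k -> set (borel X)),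
                       is_partition P /\ h = (partition_entropy P)%:E].

End metric_entropy.

Section saturation.
Context {R : realType} {X : pmetricType R}.
Variable T : X -> X.

Definition GK (K : set (bprob X)) : set X := [set x | Tran T x /\ Mlim T x = K].

Definition saturated_at (K : set (bprob X)) : Prop :=
  GK K !=set0 /\
  htop T (GK K) = ereal_inf [set metric_entropy T mu | mu in K].

Definition hull (n : nat) (nu : 'I_n -> bprob X) : set (bprob X) :=
  [set mu | exists w : 'I_n -> R,
     [/\ forall i, 0 <= w i, \sum_i w i = 1 &
         forall A : set (borel X), measurable A ->
           (mu A = \sum_i (w i)%:E * nu i A)%E]].

Definition transitively_convex_saturated : Prop :=
  forall K : set (bprob X),
    K `<=` invariant_measures T -> K !=set0 -> compact K -> connected K ->
    (exists n (nu : 'I_n -> bprob X),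
       (forall i, invariant_measures T (nu i)) /\ K `<=` hull nu) ->
    saturated_at K.

Definition transitively_single_saturated : Prop :=
  forall mu, invariant_measures T mu -> saturated_at [set mu].

End saturation.

Section level_sets.
Context {R : realType} {X : pmetricType R}.
Variables (T : X -> X) (alpha : bprob X -> R).

Definition I_alpha : set X :=
  [set x | (ereal_inf [set (alpha mu)%:E | mu in Mlim T x] <
            ereal_sup [set (alpha mu)%:E | mu in Mlim T x])%E].

Definition R_alpha (a : R) : set X :=
  [set x | ereal_inf [set (alpha mu)%:E | mu in Mlim T x] = a%:E /\
           ereal_sup [set (alpha mu)%:E | mu in Mlim T x] = a%:E].

Definition condA3 : Prop :=
  forall mu nu, invariant_measures T mu -> invariant_measures T nu ->
    alpha mu <> alpha nu ->
  forall J : set R, is_interval J -> J `<=` `[0, 1] ->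
    (exists a b, [/\ J a, J b & a < b]) ->
    ~ exists c, forall t : {i01 R}, J t%:num -> alpha (mix t mu nu) = c.

End level_sets.

(* Main.v *)
(** Upper bounds come from Bowen's argument: if every point x of E has an
    invariant measure mu with entropy at most h which dominates the statistics
    of its orbit along a subsequence, then htop E <= h.  For a partition with
    mu-null boundaries and a block length m such that the entropy of m-words is
    about m h, choose a code on m-words, with lengths taken from a countable
    family, whose mean length is close to that entropy.  Along the subsequence,
    one of the m ways of cutting the orbit of x into m-blocks has mean code
    length at most about m h, and by Kraft's inequality few words do.
    Elements of M_x have the domination property by the portmanteau theorem,
    and each point has such a measure: regularize an ultrafilter limit of the
    empirical frequencies.

    Lower bounds come from saturation, applied to singletons in (2), and in (1)
    to short segments K of mixtures of mu and nu with weight at least theta on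
    mu: entropy on K is at least theta h_mu, while [A.3] prevents alpha from
    being constant on K. *)

Require Import Defs.
From HB Require Import structures.
From mathcomp Require Import all_boot all_order all_algebra.
From mathcomp Require Import finmap.
From mathcomp Require Import all_classical all_reals all_analysis.
From mathcomp Require Import measurable_realfun.
From mathcomp Require Import zify ring lra.
Import Order.TTheory GRing.Theory Num.Theory.
Import numFieldNormedType.Exports.

Set Implicit Arguments.
Unset Strict Implicit.
Unset Printing Implicit Defensive.

Local Open Scope classical_set_scope.
Local Open Scope ring_scope.

(** * Bowen's entropy as an outer measure *)

(** The points of [E] come with different measures, possibly uncountably many, and with no common
    time from which their statistics hold. Codes remove both obstacles. Only countably many vectors
    of code lengths occur, so [E] lies in a countable union of sets [often_coded], and a
    Borel-Cantelli sum makes [bowen_Cn] vanish on each of them at every fixed [n]. As [bowen_Cn] is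
    an outer measure for fixed [n], it vanishes on the union too, before any limit is taken. Code
    lengths are nonnegative, so upper bounds on frequencies are enough. This is why the one-sided
    property [dominates] suffices, and why regularizing a merely finitely additive limit of
    frequencies does no harm: closed sets can only gain mass. In (1) the upper bound concerns all of
    [X], hence a dominating measure at every point; this is the half of the variational principle
    that bounds [htop] by entropies of invariant measures. In (2) the measure must also satisfy
    [alpha mu = a], so it has to come from [Mlim] itself. *)

Section sums.
Context {R : realType}.
Local Open Scope ereal_scope.

Lemma subset_esum_le (I : choiceType) (A B : set I) (a : I -> \bar R) :
  A `<=` B -> \esum_(i in A) a i <= \esum_(i in B) a i.
Proof.
move=> AB; apply: ereal_sup_le => _ [F [finF FA] <-].
by exists F => //; split=> //; exact: subset_trans FA AB.
Qed.

Lemma esum_bigcup_le (I : choiceType) (J : (set I)^nat) (a : I -> \bar R) :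
  (forall i, 0 <= a i) ->
  \esum_(i in \bigcup_n J n) a i <= \sum_(n <oo) \esum_(i in J n) a i.
Proof.
move=> a0; rewrite seqDU_bigcup_eq (nneseries_sum_bigcup (trivIset_seqDU J) a0).
apply: lee_nneseries => [i _ _|i _]; first exact: esum_ge0.
by apply: subset_esum_le; exact: subset_seqDU.
Qed.

Lemma nneseries_le (u : (\bar R)^nat) M : (forall n, 0 <= u n) ->
  (forall n, \sum_(i < n) u i <= M) -> \sum_(i <oo) u i <= M.
Proof.
move=> u0 uM; apply: lime_le; first exact: is_cvg_nneseries.
by apply: nearW => n; rewrite big_mkord.
Qed.

End sums.

Section bowen.
Context {R : realType} {X : pmetricType R}.
Variable T : X -> X.
Local Open Scope ereal_scope.

Lemma bowen_Cn_ge0 E t n e : 0 <= bowen_Cn T E t n e.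
Proof.
apply: le_ereal_inf_tmp => _ [C _ <-]; apply: esum_ge0 => p _.
by rewrite lee_fin powR_ge0.
Qed.

Lemma le_bowen_Cn E F t n e : E `<=` F -> bowen_Cn T E t n e <= bowen_Cn T F t n e.
Proof.
move=> EF; apply: ereal_inf_le_tmp => _ [C [Cc Cn FC] <-].
by exists C => //; split=> //; exact: subset_trans EF FC.
Qed.

Lemma bowen_Cn_homo E t e : {homo bowen_Cn T E t ^~ e : n m / (n <= m)%N >-> n <= m}.
Proof.
move=> n m nm; apply: ereal_inf_le_tmp => _ [C [Cc Cn FC] <-].
by exists C => //; split=> // p /Cn; exact: leq_trans.
Qed.

Lemma bowen_Cn_set0 t n e : bowen_Cn T set0 t n e = 0.
Proof.
apply/eqP; rewrite eq_le bowen_Cn_ge0 andbT; apply: ereal_inf_lbound.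
by exists set0; [split=> // x []|exact: esum_set0].
Qed.

(** Near-optimal covers of the pieces, with excess [d / 2 ^ i.+1] for the [i]-th one, unite to a
    cover of the union whose lengths are still at least [n]. *)
Lemma bowen_Cn_sigma_subadditive t n e :
  sigma_subadditive (fun E => bowen_Cn T E t n e).
Proof.
move=> A; set mu := fun E => bowen_Cn T E t n e.
have mu0 E : 0 <= mu E by exact: bowen_Cn_ge0.
have [[i ioo]|] := pselect (exists i, mu (A i) = +oo).
  rewrite (eseries_pinfty _ _ ioo) ?leey// => k _.
  by rewrite -ltNye (lt_le_trans _ (mu0 _)).
rewrite -forallNE => Aoo; apply/lee_addgt0Pr => d d0.
apply: (le_trans _ (epsilon_trick _ _ (ltW d0))); last by move=> i; exact: mu0.
have /choice[G PG] : forall i, exists C, bowen_covers T (A i) n e C /\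
    \esum_(p in C) (2 `^ (- (t * p.2%:R)))%:E <= mu (A i) + (d / (2 ^ i.+1)%:R)%:E.
  move=> i; have fi : mu (A i) \is a fin_num.
    by rewrite ge0_fin_numE// ltey; apply/eqP/Aoo.
  have di : (0 < d / (2 ^ i.+1)%:R)%R by rewrite divr_gt0// ltr0n expn_gt0.
  have [_ [C CA <-] /ltW] := lb_ereal_inf_adherent di fi.
  by exists C.
have GA : bowen_covers T (\bigcup_i A i) n e (\bigcup_i G i).
  split.
  - by apply: bigcup_countable => // i _; have [[]] := PG i.
  - by move=> p [i _]; have [[_ + _] _] := PG i; apply.
  - move=> x [i _ Aix]; have [[_ _ /(_ _ Aix)[p Gp xp]] _] := PG i.
    by exists p => //; exists i.
apply: (@le_trans _ _
    (\esum_(p in \bigcup_i G i) (2 `^ (- (t * p.2%:R)))%:E)).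
  by apply: ereal_inf_lbound; exists (\bigcup_i G i).
apply: (le_trans (esum_bigcup_le _ _)) => [p|].
  by rewrite lee_fin powR_ge0.
apply: lee_nneseries => [i _ _|i _]; last by have [] := PG i.
by apply: esum_ge0 => p _; rewrite lee_fin powR_ge0.
Qed.

(** The set argument comes last, so that the outer measure structure can be attached to a set
    function. *)
Definition bowen_outer t n e (E : set X) := bowen_Cn T E t n e.

HB.instance Definition _ t n e := isOuterMeasure.Build R X (bowen_outer t n e)
  (bowen_Cn_set0 t n e) (fun E => bowen_Cn_ge0 E t n e)
  (fun E F => @le_bowen_Cn E F t n e) (@bowen_Cn_sigma_subadditive t n e).

Lemma bowen_Cn_finsub (I : finType) (G : I -> set X) t n e :
  bowen_Cn T [set x | exists i, G i x] t n e <= \sum_i bowen_Cn T (G i) t n e.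
Proof.
suff H (s : seq I) : bowen_outer t n e [set x | exists2 i, i \in s & G i x] <=
    \sum_(i <- s) bowen_outer t n e (G i).
  apply: le_trans (H _); apply: le_bowen_Cn => x [i Gx].
  by exists i => //; rewrite mem_index_enum.
elim: s => [|i s IH].
  rewrite big_nil (_ : [set _ | _] = set0) ?outer_measure0//.
  by rewrite -subset0 => x [].
rewrite big_cons; apply: le_trans (leeD (lexx _) IH).
apply: le_trans (outer_measureU2 _ _ _); apply: le_outer_measure => x [j].
by rewrite in_cons => /predU1P[->|js] Gx; [left|right; exists j].
Qed.

Lemma bowen_Cn_ball (E : set X) x m t n e : (n <= m)%N ->
  E `<=` bowen_ball T m x e -> bowen_Cn T E t n e <= (2 `^ (- (t * m%:R)))%:E.
Proof.
move=> nm Ex; apply: ereal_inf_lbound; exists [set (x, m)].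
  split=> [|_ ->//|y /Ex Ey]; first exact: countable1.
  by exists (x, m).
by rewrite esum_set1// lee_fin powR_ge0.
Qed.

Lemma bowen_C_eq0 E t e : (forall n, bowen_Cn T E t n e = 0) -> bowen_C T E t e = 0.
Proof.
by move=> E0; rewrite /bowen_C (_ : (fun n => _) = cst 0) ?lim_cst//; exact/funext.
Qed.

Lemma bowen_C_le E F t e e' : E `<=` F -> (e <= e')%R ->
  bowen_C T E t e' <= bowen_C T F t e.
Proof.
move=> EF ee'; apply: lee_lim; do ?exact/ereal_nondecreasing_is_cvgn/bowen_Cn_homo.
apply: nearW => n; apply: (le_trans (le_bowen_Cn _ _ _ EF)).
apply: ereal_inf_le_tmp => _ [C [Cc Cn FC] <-]; exists C => //; split=> //.
move=> x /FC[p Cp xp]; exists p => // j jp; exact: le_trans (xp j jp) ee'.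
Qed.

Lemma bowen_C_ge0 E t e : 0 <= bowen_C T E t e.
Proof.
apply: lime_ge; first exact/ereal_nondecreasing_is_cvgn/bowen_Cn_homo.
by apply: nearW => n; exact: bowen_Cn_ge0.
Qed.

Lemma htop_at_le E F e e' : E `<=` F -> (e <= e')%R ->
  htop_at T E e' <= htop_at T F e.
Proof.
move=> EF ee'; apply: ereal_inf_le_tmp => _ [t [t0 Ct] <-]; exists t => //.
split=> //; apply/eqP; rewrite eq_le bowen_C_ge0 andbT -Ct.
exact: bowen_C_le.
Qed.

Lemma htop_at_cvg E : cvg (htop_at T E e @[e --> 0%R^'+]).
Proof.
apply: nonincreasing_at_right_is_cvge; apply: nearW => x.
by move=> e e' _ _; exact: htop_at_le.
Qed.

Lemma htop_le E F : E `<=` F -> htop T E <= htop T F.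
Proof.
move=> EF; apply: lee_lim; do ?exact: htop_at_cvg.
by apply: nearW => e; exact: htop_at_le.
Qed.

Lemma htop_le_bowen_C E (t : R) : (0 <= t)%R ->
  (forall e, (0 < e)%R -> bowen_C T E t e = 0) -> htop T E <= t%:E.
Proof.
move=> t0 Et; apply: lime_le; first exact: htop_at_cvg.
near=> e; apply: ereal_inf_lbound; exists t => //; split=> //; apply: Et.
by near: e; exact: nbhs_right_gt.
Unshelve. all: by end_near. Qed.

Lemma bowen_Cn_bigcup0 (I : countType) (G : I -> set X) t n e :
  (forall i, bowen_Cn T (G i) t n e = 0) ->
  bowen_Cn T [set x | exists i, G i x] t n e = 0.
Proof.
move=> G0; apply/eqP; rewrite eq_le bowen_Cn_ge0 andbT.
pose F k := if choice.unpickle k is Some i then G i else set0.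
have sub : [set x | exists i, G i x] `<=` \bigcup_k F k.
  by move=> x [i Gx]; exists (choice.pickle i) => //; rewrite /F choice.pickleK.
apply: le_trans (le_bowen_Cn _ _ _ sub) _.
apply: le_trans (bowen_Cn_sigma_subadditive _ _ _ _) _.
rewrite eseries0// => k _ _; rewrite /F; case: (choice.unpickle k) => //.
exact: bowen_Cn_set0.
Qed.

End bowen.

(** * Covering by coded itineraries *)

(** The boolean [i < r] counts the extra term that the incomplete last block gives to the residues
    below [r]. This splits a sum over times into [m] sums over disjoint blocks, one for each
    phase. *)
Lemma sum_residues (R : pzRingType) (f : nat -> R) q m r : (r <= m)%N ->
  \sum_(j < q * m + r) f j = \sum_(i < m) \sum_(j < q + (i < r)) f (i + j * m)%N.
Proof.
move=> rm; elim: q f => [|q IH] f.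
  rewrite mul0n (big_ord_widen m f rm) big_mkcond/=; apply: eq_bigr => i _.
  by case: ltnP => _; rewrite ?big_ord0// big_ord_recl big_ord0 addr0 mul0n addn0.
rewrite mulSn -addnA big_split_ord/= (IH (fun j => f (m + j)%N)) -big_split/=.
apply: eq_bigr => i _; rewrite addSn big_ord_recl mul0n addn0; congr (_ + _).
by apply: eq_bigr => j _; rewrite mulSn addnCA.
Qed.

Section coding.
Context {R : realType} {X : pmetricType R}.
Variables (T : X -> X) (k m : nat) (c : 'I_k -> X) (e h : R).
Variable L : {ffun 'I_m -> 'I_k} -> R.

Definition block (u : nat -> 'I_k) (a : nat) : {ffun 'I_m -> 'I_k} :=
  [ffun l : 'I_m => u (a + l)%N].

(* The first i letters are a phase shift, at most m - 1, and stay uncoded. *)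
Definition coded (i J : nat) : set X := [set x | exists u : nat -> 'I_k,
  (forall l, (l < i + J * m)%N -> mdist (iter l T x) (c (u l)) <= e) /\
  \sum_(j < J) L (block u (i + j * m)) <= (J * m)%:R * h].

(** A lim sup set: the statistics of an orbit are controlled only along a subsequence of times, and
    the phase [i] may change with [J]. *)
Definition often_coded : set X := [set x | forall J0, exists J i,
  [/\ (J0 <= J)%N, (i < m)%N & coded i J x]].

Hypothesis kraft : \sum_w 2 `^ (- L w) <= 1.
Hypotheses (m0 : (0 < m)%N) (k0 : (0 < k)%N).
Variable s : R.
Hypotheses (s0 : 0 <= s) (hs : h < s).

(** Points with the same [i] free letters and the same [J] blocks stay [2 * e]-close for [i + J * m]
    steps. There are [k ^ i] choices of free letters, and Kraft's inequality allows about
    [2 ^ (J * m * h)] sequences of blocks of total code length at most [J * m * h]. *)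
Lemma bowen_Cn_coded i J N : (N <= i + J * m)%N ->
  (bowen_Cn T (coded i J) s N (2 * e) <=
   (k%:R ^+ i * 2 `^ (- (s * (i + J * m)%:R) + (J * m)%:R * h))%:E)%E.
Proof.
move=> NJ.
pose I : finType := ({ffun 'I_i -> 'I_k} * {ffun 'I_J -> {ffun 'I_m -> 'I_k}})%type.
pose G (ab : I) := [set x | exists u : nat -> 'I_k,
  [/\ forall l, (l < i + J * m)%N -> mdist (iter l T x) (c (u l)) <= e,
      \sum_(j < J) L (ab.2 j) <= (J * m)%:R * h,
      forall l : 'I_i, ab.1 l = u l &
      forall j : 'I_J, ab.2 j = block u (i + j * m)]].
have cG : coded i J `<=` [set x | exists ab, G ab x].
  move=> x [u [xu Lu]].
  exists ([ffun l : 'I_i => u l], [ffun j : 'I_J => block u (i + j * m)]), u.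
  split=> //= [|l|j]; rewrite ?ffunE//.
  by under eq_bigr do rewrite ffunE.
apply: (le_trans (le_bowen_Cn _ _ _ _ cG)).
apply: (le_trans (bowen_Cn_finsub _ _ _ _ _)).
pose K := 2 `^ (- (s * (i + J * m)%:R) + (J * m)%:R * h).
(* Weights replace counting. A nonempty [G ab] has total code length at most [J * m * h], so the
   factor [2 ^ (J * m * h)] in [K] compensates the Kraft weight of [ab.2]. Summed over all [ab.2],
   the weights factor into the [J]-th power of the Kraft sum. *)
have Gab ab : (bowen_Cn T (G ab) s N (2 * e) <=
    (K * \prod_(j < J) 2 `^ (- L (ab.2 j)))%:E)%E.
  have [[y Gy]|G0] := pselect (G ab !=set0); last first.
    rewrite (_ : G ab = set0) ?bowen_Cn_set0.
      by rewrite lee_fin mulr_ge0// ?powR_ge0// prodr_ge0// => j _; rewrite powR_ge0.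
    by apply/seteqP; split=> // x Gx; apply: G0; exists x.
  apply: (@le_trans _ _ (2 `^ (- (s * (i + J * m)%:R)))%:E).
    (* The ball is centred at a point [y] of [G ab], at distance at most [e] from each [c (u l)]:
       this doubles the radius. *)
    apply: (@bowen_Cn_ball _ _ _ _ y) => // z [v [zv _ v1 v2]] l lJ.
    have [u [yu _ u1 u2]] := Gy.
    have -> : 2 * e = e + e by rewrite mulr_natl mulr2n.
    apply: le_trans (metric_triangle _ (c (u l)) _) _.
    apply: lerD; first exact: yu.
    suff -> : u l = v l by rewrite metric_sym; exact: zv.
    have [li|il] := ltnP l i.
      by rewrite -(u1 (Ordinal li)) -(v1 (Ordinal li)).
    have jJ : ((l - i) %/ m < J)%N by rewrite ltn_divLR//; lia.
    have rm : ((l - i) %% m < m)%N by rewrite ltn_mod.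
    have := u2 (Ordinal jJ); rewrite v2 => /ffunP/(_ (Ordinal rm)).
    by rewrite !ffunE/= -addnA -divn_eq subnKC// => ->.
  have [u [_ Lu _ _]] := Gy.
  rewrite lee_fin -[leLHS]mulr1 /K powRD; last by rewrite pnatr_eq0 implybT.
  rewrite -mulrA ler_pM2l ?powR_gt0//.
  have -> : \prod_(j < J) 2 `^ (- L (ab.2 j)) = (2:R) `^ (- \sum_(j < J) L (ab.2 j)).
    rewrite -sumrN; elim/big_rec2: _ => [|j y1 y2 _ ->]; first by rewrite powRr0.
    by rewrite powRD// pnatr_eq0 implybT.
  rewrite -powRD; last by rewrite pnatr_eq0 implybT.
  by rewrite -[leLHS](@powRr0 _ 2) ler_powR ?ler1n// subr_ge0.
apply: (le_trans (lee_sum _ (fun ab _ => Gab ab))).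
rewrite sumEFin lee_fin -mulr_sumr mulrC ler_pM2r ?powR_gt0//.
rewrite -(pair_bigA _ (fun (a : {ffun 'I_i -> 'I_k})
  (b : {ffun 'I_J -> {ffun 'I_m -> 'I_k}}) => \prod_(j < J) 2 `^ (- L (b j))))/=.
rewrite sumr_const card_ffun !card_ord -[leLHS]mulr_natl natrX.
rewrite -[leRHS]mulr1 ler_pM2l ?exprn_gt0 ?ltr0n//.
rewrite -(bigA_distr_bigA (fun _ w => 2 `^ (- L w))) /=.
by rewrite prodr_const card_ord exprn_ile1// sumr_ge0// => w _; rewrite powR_ge0.
Qed.

(** Borel-Cantelli: since [h < s], the cost of [J] blocks decays like [rho ^ J], and [often_coded]
    is contained in every tail union over [J >= J0]. *)
Lemma bowen_Cn_often_coded N : bowen_Cn T often_coded s N (2 * e) = 0%E.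
Proof.
apply/eqP; rewrite eq_le bowen_Cn_ge0 andbT; apply/lee_addgt0Pr => d d0.
rewrite add0e.
pose rho : R := 2 `^ (- (m%:R * (s - h))).
have rho0 : 0 < rho by rewrite powR_gt0.
have rho1 : rho < 1.
  rewrite /rho /powR pnatr_eq0/= -[ltRHS]expR0 ltr_expR pmulr_llt0 ?ln_gt0 ?ltr1n//.
  by rewrite oppr_lt0 mulr_gt0 ?ltr0n// subr_gt0.
(* [m] phases, each with at most [k ^ m] choices of uncoded letters. *)
pose A : R := m%:R * k%:R ^+ m.
have A0 : 0 < A by rewrite mulr_gt0 ?exprn_gt0 ?ltr0n.
have [J0 NJ0 AJ0] : exists2 J0, (N <= J0)%N & A * (rho ^+ J0 / (1 - rho)) <= d.
  have B0 : 0 < d * (1 - rho) / A by rewrite !mulr_gt0 ?invr_gt0// subr_gt0.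
  have rhoc : rho ^+ n @[n --> \oo] --> 0 by apply: cvg_expr; rewrite gtr0_norm.
  have [J0 [NJ0]] : exists J0, (N <= J0)%N /\ rho ^+ J0 < d * (1 - rho) / A.
    near \oo => J0; exists J0; split; near: J0; first exact: nbhs_infty_ge.
    exact: (cvgr_lt 0).
  exists J0 => //; rewrite mulrA ler_pdivrMr ?subr_gt0// mulrC -ler_pdivlMr//.
  exact: ltW.
have sub : often_coded `<=` \bigcup_j [set x | exists i : 'I_m, coded i (J0 + j) x].
  move=> x /(_ J0)[J [i [JJ im Fx]]]; exists (J - J0)%N => //.
  by exists (Ordinal im); rewrite subnKC.
apply: (le_trans (le_bowen_Cn _ _ _ _ sub)).
apply: (le_trans (bowen_Cn_sigma_subadditive _ _ _ _ _)).
have cost j : (bowen_Cn T [set x | exists i : 'I_m, coded i (J0 + j) x] s N (2 * e)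
    <= (A * rho ^+ (J0 + j))%:E)%E.
  apply: (le_trans (bowen_Cn_finsub _ _ _ _ _)).
  have -> : A * rho ^+ (J0 + j) = \sum_(i < m) (k%:R ^+ m * rho ^+ (J0 + j)).
    by rewrite sumr_const card_ord -[RHS]mulr_natl mulrA.
  rewrite -sumEFin; apply: lee_sum => i _.
  have Ni : (N <= i + (J0 + j) * m)%N by nia.
  apply: (le_trans (bowen_Cn_coded Ni)).
  rewrite lee_fin ler_pM ?exprn_ge0 ?powR_ge0 ?ler0n//.
    by rewrite ler_weXn2l ?ler1n// ltnW.
  rewrite /rho -powR_mulrn ?powR_ge0// -powRrM ler_powR ?ler1n//.
  (* The gain [2 ^ (- s * i)] from the uncoded letters is given away. *)
  rewrite natrD natrM; have : 0 <= s * i%:R by rewrite mulr_ge0.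
  by lra.
apply: nneseries_le => [j|n]; first exact: bowen_Cn_ge0.
apply: (@le_trans _ _ (\sum_(j < n) (A * rho ^+ (J0 + j))%:E)%E).
  by apply: lee_sum => j _; exact: cost.
rewrite sumEFin lee_fin -mulr_sumr; apply: le_trans AJ0.
rewrite ler_pM2l//; under eq_bigr do rewrite exprD.
rewrite -mulr_sumr ler_pM2l ?exprn_gt0//.
rewrite -[leRHS]mul1r ler_pdivlMr ?subr_gt0// mulrC -opprB mulNr -subrX1 opprB.
by rewrite gerBl exprn_ge0// ltW.
Unshelve. all: by end_near. Qed.


(** Frequencies along an orbit concern words read at every starting time, overlapping ones included,
    whereas [coded] needs disjoint blocks. The starting times split into [m] phases of disjoint
    blocks, and a phase no worse than the average exists. *)
Lemma often_codedP (p : X -> 'I_k) x :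
  (forall y, mdist y (c (p y)) <= e) ->
  (forall N, exists2 n, (N <= n)%N &
     \sum_(j < n) L [ffun l : 'I_m => p (iter l T (iter j T x))] <=
     n%:R * (m%:R * h)) ->
  often_coded x.
Proof.
(* With [n >= J0 * m], every phase has at least [J0] blocks. *)
move=> pe often J0; have [n nJ Ln] := often (J0 * m)%N.
pose q := (n %/ m)%N; pose r := (n %% m)%N.
have rm : (r <= m)%N by rewrite ltnW// ltn_mod.
pose f j := L (block (fun l => p (iter l T x)) j).
have Lf : \sum_(j < n) f j <= n%:R * (m%:R * h).
  apply: le_trans Ln; apply: ler_sum => j _; rewrite le_eqVlt; apply/orP; left.
  by apply/eqP; congr L; apply/ffunP => l; rewrite !ffunE addnC iterD.
rewrite (divn_eq n m) -/q -/r sum_residues// in Lf.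
(* Some phase i does at least as well as the average over all m phases. *)
have [i fi] : exists i : 'I_m,
    \sum_(j < q + (i < r)) f (i + j * m)%N <= (q + (i < r))%:R * (m%:R * h).
  apply: contrapT => /forallNP H.
  have : \sum_(i < m) ((q + (i < r))%:R * (m%:R * h)) <
      \sum_(i < m) \sum_(j < q + (i < r)) f (i + j * m)%N.
    apply: ltr_sum => [|i _]; first by apply/hasP; exists (Ordinal m0).
    by rewrite ltNge; apply/negP/H.
  rewrite -mulr_suml -natr_sum.
  (* [sum_residues] for the constant 1, read in [int] because it is stated over a ring. *)
  have -> : (\sum_(i < m) (q + (i < r)) = q * m + r)%N.
    have := @sum_residues int (fun=> 1) q m r rm.
    rewrite sumr_const card_ord.
    under eq_bigr do rewrite sumr_const card_ord.
    by rewrite -natr_sum => /eqP; rewrite eqr_nat => /eqP.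
  by rewrite ltNge Lf.
exists (q + (i < r))%N, i; split=> //.
  by apply: leq_trans (leq_addr _ _); rewrite leq_divRL.
exists (fun l => p (iter l T x)); split=> [l _|]; first exact: pe.
by rewrite natrM -mulrA.
Qed.

End coding.

(** * Finite entropy and codes *)

Section log2.
Context {R : realType}.
Implicit Types x y : R.

Lemma ln2_gt0 : 0 < ln 2 :> R. Proof. by rewrite ln_gt0// ltr1n. Qed.

Lemma log2M x y : 0 < x -> 0 < y -> log2 (x * y) = log2 x + log2 y.
Proof. by move=> x0 y0; rewrite /log2 lnM ?posrE// mulrDl. Qed.

Lemma log2V x : 0 < x -> log2 x^-1 = - log2 x.
Proof. by move=> x0; rewrite /log2 lnV ?posrE// mulNr. Qed.

Lemma ler_log2 x y : 0 < x -> x <= y -> log2 x <= log2 y.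
Proof.
move=> x0 xy; rewrite /log2 ler_pM2r ?invr_gt0 ?ln2_gt0// ler_ln ?posrE//.
exact: lt_le_trans xy.
Qed.

Lemma log2_le0 x : x <= 1 -> log2 x <= 0.
Proof.
move=> x1; have [x0|x0] := leP x 0; first by rewrite /log2 ln0// mul0r.
by rewrite /log2 pmulr_lle0 ?invr_gt0 ?ln2_gt0// ln_le0.
Qed.

Lemma powR_log2 x : 0 < x -> 2 `^ (log2 x) = x.
Proof.
by move=> x0; rewrite /powR pnatr_eq0/= /log2 mulfVK ?lnK ?posrE// gt_eqF ?ln2_gt0.
Qed.

Lemma log2_le_linear x : 0 <= x -> log2 (1 + x) <= x / ln 2.
Proof.
move=> x0; rewrite /log2 ler_pM2r ?invr_gt0 ?ln2_gt0// le_ln1Dx//.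
by apply: lt_le_trans x0; rewrite oppr_lt0.
Qed.

End log2.

Section entropy.
Context {R : realType} {I : finType}.
Implicit Types p q : I -> R.

Definition entropy p : R := - \sum_i p i * log2 (p i).

Lemma entropy_ge0 p : (forall i, 0 <= p i <= 1) -> 0 <= entropy p.
Proof.
move=> p01; rewrite /entropy -sumrN sumr_ge0// => i _.
by have /andP[p0 p1] := p01 i; rewrite -mulrN mulr_ge0// oppr_ge0 log2_le0.
Qed.

(** Termwise [ln (q / p) <= q / p - 1]. Absolute continuity is required because [log2 0] is 0 here,
    which would hide an infinite cross entropy. Only the inequality between the total masses enters,
    so [q] may be a sub-probability. *)
Lemma gibbs p q : (forall i, 0 <= p i) -> (forall i, 0 <= q i) ->
  (forall i, q i = 0 -> p i = 0) -> \sum_i q i <= \sum_i p i ->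
  entropy p <= - \sum_i p i * log2 (q i).
Proof.
move=> p0 q0 pq qp; rewrite lerN2 -subr_ge0 -sumrB.
have H i : (p i - q i) / ln 2 <= p i * log2 (p i) - p i * log2 (q i).
  rewrite -mulrBr /log2 -mulrBl mulrA ler_pM2r ?invr_gt0 ?ln2_gt0//.
  have [pi0|pi0] := eqVneq (p i) 0; first by rewrite pi0 mul0r sub0r oppr_le0.
  have pp : 0 < p i by rewrite lt_neqAle eq_sym pi0 p0.
  have qq : 0 < q i by rewrite lt_neqAle eq_sym q0 andbT; apply: contra_neq pi0 => /pq.
  rewrite -lerN2 -mulrN !opprB -ln_div ?posrE//.
  have -> : q i / p i = 1 + (q i / p i - 1) by rewrite addrC subrK.
  apply: (@le_trans _ _ (p i * (q i / p i - 1))).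
    by rewrite ler_pM2l// le_ln1Dx// ltrBrDl subrr divr_gt0.
  by rewrite mulrBr mulr1 mulrC divfK.
apply: le_trans (ler_sum _ (fun i _ => H i)).
by rewrite -mulr_suml sumrB mulr_ge0 ?subr_ge0// invr_ge0 ltW// ln2_gt0.
Qed.

(** By [gibbs], coding [p] with lengths adapted to the mixture costs at least [entropy p]; the share
    of [q] in the entropy of the mixture is nonnegative and is dropped. *)
Lemma entropy_mix (t : R) p q : 0 < t <= 1 -> (forall i, 0 <= p i) ->
  (forall i, 0 <= q i) -> \sum_i p i = 1 -> \sum_i q i = 1 ->
  t * entropy p <= entropy (fun i => t * p i + (1 - t) * q i).
Proof.
move=> /andP[t0 t1] p0 q0 p1 q1; set r := fun i => _.
have t'0 : 0 <= 1 - t by rewrite subr_ge0.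
have r0 i : 0 <= r i by rewrite addr_ge0 ?mulr_ge0// ltW.
have r1 : \sum_i r i = 1.
  by rewrite big_split/= -!mulr_sumr p1 q1 !mulr1 addrC subrK.
have rle i : r i <= 1 by rewrite -r1 (bigD1 i)//= lerDl sumr_ge0.
have pr : entropy p <= - \sum_i p i * log2 (r i).
  apply: gibbs => //; last by rewrite r1 p1.
  move=> i /eqP; rewrite /r paddr_eq0 ?mulr_ge0 ?(ltW t0)// mulf_eq0 gt_eqF//=.
  by move=> /andP[/eqP].
apply: (@le_trans _ _ (t * - \sum_i p i * log2 (r i))); first by rewrite ler_pM2l.
rewrite /entropy mulrN lerN2 mulr_sumr; apply: ler_sum => i _.
have : log2 (r i) <= 0 by exact: log2_le0.
have -> l : r i * l = t * (p i * l) + (1 - t) * q i * l by rewrite /r; ring.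
by move=> l0; rewrite gerDl mulr_ge0_le0 ?mulr_ge0.
Qed.

End entropy.

(** [gibbs] against the product of the two marginals. Injectivity embeds [I] into [J * K], so the
    product has mass at most 1 on [I]. *)
Lemma entropy_marginals (R : realType) (I J K : finType) (f : I -> J) (g : I -> K)
    (p : I -> R) :
  injective (fun i => (f i, g i)) -> (forall i, 0 <= p i) -> \sum_i p i = 1 ->
  entropy p <= entropy (fun j => \sum_(i | f i == j) p i) +
               entropy (fun k => \sum_(i | g i == k) p i).
Proof.
move=> fg p0 p1; set pf := fun j => _; set pg := fun k => _.
have pf0 j : 0 <= pf j by exact: sumr_ge0.
have pg0 k : 0 <= pg k by exact: sumr_ge0.
have pf1 : \sum_j pf j = 1 by rewrite -p1 (partition_big f predT).
have pg1 : \sum_k pg k = 1 by rewrite -p1 (partition_big g predT).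
have lepf i : p i <= pf (f i) by rewrite /pf (bigD1 i)//= lerDl sumr_ge0.
have lepg i : p i <= pg (g i) by rewrite /pg (bigD1 i)//= lerDl sumr_ge0.
apply: (@le_trans _ _ (- \sum_i p i * log2 (pf (f i) * pg (g i)))).
  apply: gibbs => // [i|i|].
  - by rewrite mulr_ge0.
  - move=> /eqP; rewrite mulf_eq0 => /orP[]/eqP e0; apply/eqP.
      by rewrite eq_le p0 -e0 lepf.
    by rewrite eq_le p0 -e0 lepg.
  - rewrite p1 -(@mulr1 R 1) -{1}pf1 -pg1 big_distrlr/= pair_bigA/=.
    rewrite -(big_imset (fun jk => pf jk.1 * pg jk.2) (in2W fg))/=.
    rewrite [leRHS](bigID [in [set (f i, g i) | i in I]%SET])/= lerDl.
    by rewrite sumr_ge0// => jk _; rewrite mulr_ge0.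
have -> : entropy pf = - \sum_i p i * log2 (pf (f i)).
  rewrite /entropy (partition_big f predT)//=; congr (- _); apply: eq_bigr => j _.
  by rewrite {1}/pf mulr_suml; apply: eq_bigr => i /eqP ->.
have -> : entropy pg = - \sum_i p i * log2 (pg (g i)).
  rewrite /entropy (partition_big g predT)//=; congr (- _); apply: eq_bigr => j _.
  by rewrite {1}/pg mulr_suml; apply: eq_bigr => i /eqP ->.
rewrite -opprD lerN2 -big_split/=; apply: ler_sum => i _.
have [->|pi0] := eqVneq (p i) 0; first by rewrite !mul0r addr0.
have pp : 0 < p i by rewrite lt_neqAle eq_sym pi0 p0.
rewrite log2M ?mulrDr//; first exact: lt_le_trans (lepf i).
exact: lt_le_trans (lepg i).
Qed.

Section codes.
Context {R : realType} {I : finType}.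

(* Incrementing the counts keeps every code length finite. *)
Definition count_code (c : {ffun I -> nat}) (i : I) : R :=
  - log2 ((c i).+1%:R / (\sum_j (c j).+1)%:R).

Lemma count_total_gt0 (c : {ffun I -> nat}) (i : I) : (0 < \sum_j (c j).+1)%N.
Proof. by rewrite (bigD1 i). Qed.

Lemma count_code_kraft (c : {ffun I -> nat}) :
  \sum_i 2 `^ (- count_code c i) <= 1.
Proof.
have e i : 2 `^ (- count_code c i) = (c i).+1%:R / (\sum_j (c j).+1)%:R.
  rewrite /count_code opprK powR_log2// divr_gt0// ltr0n//.
  exact: count_total_gt0 i.
under eq_bigr do rewrite e.
rewrite -mulr_suml -natr_sum.
by have [->|n0] := eqVneq (\sum_j (c j).+1)%N 0; rewrite ?mul0r// divff// pnatr_eq0.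
Qed.

Lemma count_code_ge0 (c : {ffun I -> nat}) i : 0 <= count_code c i.
Proof.
rewrite oppr_ge0 log2_le0// ler_pdivrMr ?mul1r ?ltr0n ?(count_total_gt0 c i)//.
by rewrite ler_nat (bigD1 i)//= leq_addr.
Qed.

(** Round [M * p i] down: the incremented count is at least [M * p i] and the total at most
    [M + #|I|]. Each length thus exceeds [- log2 (p i)] by at most [log2 (1 + #|I| / M)], so natural
    counts, a countable family, serve all probability vectors. *)
Lemma count_code_approx (p : I -> R) (e : R) : 0 < e -> (forall i, 0 <= p i) ->
  \sum_i p i = 1 ->
  exists c : {ffun I -> nat}, \sum_i p i * count_code c i <= entropy p + e.
Proof.
move=> e0 p0 p1.
(* Large enough for [#|I| / (M * ln 2) <= e], which bounds [log2 D] below. *)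
pose M := (Num.truncn (#|I|%:R / (ln 2 * e))).+1.
have M0 : 0 < M%:R :> R by rewrite ltr0n.
have IM : #|I|%:R / M%:R / ln 2 <= e.
  rewrite mulrAC ler_pdivrMr// -ler_pdivrMl// mulrC -mulrA -invfM.
  exact/ltW/truncnS_gt.
pose c := [ffun i => Num.truncn (M%:R * p i)].
exists c.
pose D : R := 1 + #|I|%:R / M%:R.
have D0 : 0 < D by rewrite ltr_wpDr// divr_ge0.
have cD i : 0 < p i -> count_code c i <= - log2 (p i) + log2 D.
  move=> pi0; rewrite -(opprK (log2 D)) -opprD lerN2 -log2V// -log2M ?invr_gt0//.
  apply: ler_log2; first by rewrite mulr_gt0 ?invr_gt0.
  rewrite ler_pdivlMr ?ltr0n ?(count_total_gt0 c i)//.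
  have tot : (\sum_j (c j).+1)%:R <= M%:R * D.
    rewrite natr_sum /D mulrDr mulr1 mulrCA divff ?gt_eqF// mulr1.
    have -> : M%:R + #|I|%:R = \sum_j (M%:R * p j + 1).
      by rewrite big_split/= -mulr_sumr p1 mulr1 sumr_const.
    apply: ler_sum => j _; rewrite -natr1 lerD2r ffunE.
    by rewrite truncn_le mulr_ge0// ltW.
  apply: (@le_trans _ _ (p i / D * (M%:R * D))).
    by rewrite ler_pM2l// divr_gt0.
  rewrite mulrCA divfK ?gt_eqF// ffunE; exact/ltW/truncnS_gt.
apply: (@le_trans _ _ (\sum_i (- (p i * log2 (p i)) + p i * log2 D))).
  apply: ler_sum => i _; have [->|pi0] := eqVneq (p i) 0.
    by rewrite !mul0r oppr0 addr0.
  have pp : 0 < p i by rewrite lt_neqAle eq_sym pi0 p0.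
  by rewrite -mulrN -mulrDr ler_pM2l// cD.
rewrite big_split/= sumrN -mulr_suml p1 mul1r lerD2l.
by apply: le_trans IM; apply: log2_le_linear; rewrite divr_ge0.
Qed.

End codes.

(** Euclidean division of [n] by an [m] for which [a m / m] is almost the infimum; the remainder
    costs at most the constant [C], which disappears after division by [n]. *)
Lemma fekete (R : realType) (a : R^nat) : (forall n, 0 <= a n) ->
  (forall n m, a (n + m)%N <= a n + a m) -> cvgn (fun n => a n / n%:R).
Proof.
move=> a0 asub.
have aM q m r : a (q * m + r)%N <= q%:R * a m + r%:R * a 1%N + a 0%N.
  elim: q => [|q IH].
    rewrite mul0n add0n mul0r add0r; elim: r => [|r IH]; first by rewrite mul0r add0r.
    rewrite -[in leLHS]addn1; apply: le_trans (asub _ _) _.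
    rewrite -natr1 mulrDl mul1r; lra.
  rewrite mulSn -addnA; apply: le_trans (asub _ _) _.
  rewrite -natr1 mulrDl mul1r; lra.
(* Index 0 is excluded: [a 0 / 0] is 0 by convention and could spoil the infimum. *)
pose S := [set a n / n%:R | n in [set n | (0 < n)%N]].
have hS : has_inf S.
  split; first by exists (a 1%N / 1%:R); exists 1%N.
  by exists 0 => _ [n _ <-]; rewrite divr_ge0.
apply/cvg_ex; exists (inf S); apply/cvgrPdist_le => e e0.
have e20 : 0 < e / 2 by rewrite divr_gt0.
have [_ [m m0 <-] am] := inf_adherent e20 hS.
pose C := m%:R * a 1%N + a 0%N.
have C0 : 0 <= C by rewrite addr_ge0 ?mulr_ge0.
near=> n.
have n0 : (0 < n)%N by near: n; exact: nbhs_infty_gt.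
have nR : 0 < n%:R :> R by rewrite ltr0n.
have Sn : inf S <= a n / n%:R.
  by apply: inf_lbound; [exact: hS.2|exists n].
rewrite ler_norml; apply/andP; split; last first.
  by rewrite lerBlDr; apply: le_trans Sn _; rewrite lerDr ltW.
rewrite lerBrDl lerBlDr.
have Cn : C <= e / 2 * n%:R.
  by rewrite mulrC -ler_pdivrMr//; near: n; exact: nbhs_infty_ger.
have mR : 0 < m%:R :> R by rewrite ltr0n.
have := aM (n %/ m)%N m (n %% m)%N; rewrite -divn_eq => an.
rewrite ler_pdivrMr//; apply: le_trans an _.
have rm : (n %% m)%:R * a 1%N <= m%:R * a 1%N.
  by rewrite ler_wpM2r// ler_nat ltnW// ltn_mod.
have qa : (n %/ m)%:R * a m <= n%:R * (a m / m%:R).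
  rewrite mulrA mulrAC ler_pM ?divr_ge0// ler_pdivlMr// -natrM ler_nat.
  exact: leq_trunc_div.
have qa' : n%:R * (a m / m%:R) <= n%:R * (inf S + e / 2) by rewrite ler_pM2l// ltW.
move: Cn; rewrite /C; lra.
Unshelve. all: by end_near. Qed.

(** * Entropy of itineraries *)

Section borel_sets.
Context {R : realType} {X : pmetricType R}.
Implicit Types A B : set (borel X).

Lemma open_borel (A : set X) : open A -> measurable (A : set (borel X)).
Proof. by move=> oA; apply: sub_sigma_algebra. Qed.

Lemma closed_borel (A : set X) : closed A -> measurable (A : set (borel X)).
Proof.
by move=> /closed_openC/open_borel/measurableC; rewrite setCK.
Qed.

Lemma borel_preimage (f : X -> X) A : continuous f -> measurable A ->
  measurable (f @^-1` A : set (borel X)).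
Proof.
move=> cf mA.
have mf : measurable_fun [set: borel X] (f : borel X -> borel X).
  apply: (@measurability _ _ (borel X) (borel X) setT f (@open X)) => // _ [B oB <-].
  by rewrite setTI; apply: open_borel; move/continuousP : cf; apply.
by have := mf measurableT _ mA; rewrite setTI.
Qed.

Lemma fine_borel (mu : probability (borel X) R) A : measurable A ->
  (fine (mu A))%:E = mu A.
Proof. by move=> mA; rewrite fineK// fin_num_measure. Qed.

Lemma fine_le_borel (mu : probability (borel X) R) A B : measurable A ->
  measurable B -> A `<=` B -> fine (mu A) <= fine (mu B).
Proof.
by move=> mA mB AB; rewrite fine_le ?fin_num_measure// le_measure ?inE.
Qed.

Lemma fine_borel01 (mu : probability (borel X) R) A : measurable A ->
  0 <= fine (mu A) <= 1.
Proof.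
move=> mA; rewrite fine_ge0//= -lee_fin fine_borel//; exact: probability_le1.
Qed.

Lemma probability_fibers (mu : probability (borel X) R) (I : finType)
    (g : X -> I) B : measurable B ->
  (forall i, measurable (g @^-1` [set i] : set (borel X))) ->
  fine (mu B) = \sum_i fine (mu (B `&` g @^-1` [set i])).
Proof.
move=> mB mg; apply: EFin_inj; rewrite -sumEFin fine_borel//.
rewrite (eq_bigr (fun i => mu (B `&` g @^-1` [set i]))); last first.
  by move=> i _; rewrite fine_borel//; exact: measurableI.
rewrite fsbig_seq ?index_enum_uniq//= -measure_fin_bigcup//=.
- congr (mu _); apply/seteqP; split=> [y By|y [i _ []]//].
  by exists (g y) => //=; rewrite mem_index_enum.
- by move=> i j _ _ [y [[_ <-] [_ <-]]].
- by move=> i _; exact: measurableI.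
Qed.

End borel_sets.

Section itineraries.
Context {R : realType} {X : pmetricType R}.
Variables (T : X -> X) (k : nat) (p : X -> 'I_k).

Definition itin (n : nat) (y : X) : {ffun 'I_n -> 'I_k} :=
  [ffun l : 'I_n => p (iter l T y)].

Hypothesis cT : continuous T.
Hypothesis mp : forall i, measurable (p @^-1` [set i] : set (borel X)).

Lemma iter_preimage_measurable n (A : set (borel X)) : measurable A ->
  measurable (iter n T @^-1` A : set (borel X)).
Proof.
elim: n A => // n IH A mA.
by have := borel_preimage cT (IH A mA); rewrite (_ : _ @^-1` _ = iter n.+1 T @^-1` A)//;
  apply/seteqP; split=> y /=; rewrite -iterSr.
Qed.

Lemma itin_preimage n (w : {ffun 'I_n -> 'I_k}) :
  itin n @^-1` [set w] = \bigcap_(i : 'I_n) (iter i T @^-1` (p @^-1` [set w i])).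
Proof.
apply/seteqP; split=> y /=; first by move=> <- i _ /=; rewrite ffunE.
by move=> yw; apply/ffunP => i; rewrite ffunE yw.
Qed.

Lemma itin_measurable n w : measurable (itin n @^-1` [set w] : set (borel X)).
Proof.
rewrite itin_preimage; apply: fin_bigcap_measurable => // i _.
exact: iter_preimage_measurable.
Qed.

Variable mu : probability (borel X) R.

Definition word_prob n (w : {ffun 'I_n -> 'I_k}) : R :=
  fine (mu (itin n @^-1` [set w])).

Lemma word_prob_ge0 n w : 0 <= @word_prob n w. Proof. exact: fine_ge0. Qed.

Lemma word_prob01 n w : 0 <= @word_prob n w <= 1.
Proof. by apply: fine_borel01; exact: itin_measurable. Qed.

Lemma sum_word_prob n : \sum_w @word_prob n w = 1.
Proof.
rewrite /word_prob.
under eq_bigr do rewrite -[_ @^-1` _]setTI.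
rewrite -(@probability_fibers _ _ mu _ (itin n) setT)// ?probability_setT//.
exact: itin_measurable.
Qed.

Hypothesis mu_inv : forall A : set (borel X), measurable A -> mu (T @^-1` A) = mu A.

Lemma iter_invariant n (A : set (borel X)) : measurable A ->
  mu (iter n T @^-1` A) = mu A.
Proof.
elim: n A => // n IH A mA; rewrite -(IH A mA) -(mu_inv (iter_preimage_measurable n mA)).
by congr (mu _); apply/seteqP; split=> y /=; rewrite -iterSr.
Qed.

(** [f] extracts the subword that starts at position [a]; by invariance of [mu] its law does not
    depend on [a]. It is used for prefixes and suffixes. *)
Lemma word_prob_marginal n m a (f : {ffun 'I_n -> 'I_k} -> {ffun 'I_m -> 'I_k}) u :
  (forall y, f (itin n y) = itin m (iter a T y)) ->
  \sum_(w | f w == u) word_prob w = word_prob u.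
Proof.
move=> fE; rewrite [RHS]/word_prob -(iter_invariant a (@itin_measurable m u)).
rewrite (@probability_fibers _ _ mu _ (itin n)); last 2 first.
- by apply: iter_preimage_measurable; exact: itin_measurable.
- exact: itin_measurable.
rewrite big_mkcond/=; apply: eq_bigr => w _; case: eqP => fw.
  congr (fine (mu _)); apply/seteqP; split=> [y yw|y []//]; split=> //=.
  by rewrite -fE yw.
rewrite (_ : _ `&` _ = set0) ?measure0//; apply/seteqP; split=> // y [/=].
by rewrite -fE => fy yw; apply: fw; rewrite -fy -yw.
Qed.

Lemma word_entropy_subadditive n m :
  entropy (@word_prob (n + m)) <= entropy (@word_prob n) + entropy (@word_prob m).
Proof.
pose f (w : {ffun 'I_(n + m) -> 'I_k}) := [ffun l : 'I_n => w (lshift m l)].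
pose g (w : {ffun 'I_(n + m) -> 'I_k}) := [ffun l : 'I_m => w (rshift n l)].
have fg : injective (fun w => (f w, g w)).
  move=> w w' [/ffunP fw /ffunP gw]; apply/ffunP => i.
  rewrite -(splitK i); case: (fintype.split i) => j /=.
    by have := fw j; rewrite !ffunE.
  by have := gw j; rewrite !ffunE.
apply: le_trans (entropy_marginals fg (@word_prob_ge0 _) (sum_word_prob _)) _.
rewrite le_eqVlt; apply/orP; left; apply/eqP; congr (_ + _); rewrite /entropy;
  congr (- _); apply: eq_bigr => u _.
  rewrite (@word_prob_marginal (n + m) n 0 f)// => y.
  by apply/ffunP => l; rewrite !ffunE.
rewrite (@word_prob_marginal (n + m) m n g)// => y.
by apply/ffunP => l; rewrite !ffunE/= addnC iterD.
Qed.

Lemma word_entropy_cvg : cvgn (fun n => entropy (@word_prob n) / n%:R).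
Proof.
apply: fekete => [n|n m]; last exact: word_entropy_subadditive.
by apply: entropy_ge0 => w; exact: word_prob01.
Qed.

End itineraries.

Section partitions.
Context {R : realType} {X : pmetricType R}.
Variables (T : X -> X).

(** A labelling [p] turns the cells of the iterated joins into the fibers of [itin]. *)
Lemma is_partitionP k (P : 'I_k -> set (borel X)) : is_partition P <->
  exists p : X -> 'I_k, P = (fun i => p @^-1` [set i]) /\
    forall i, measurable (p @^-1` [set i] : set (borel X)).
Proof.
split=> [[mP tP PT]|[p [-> mp]]]; last first.
  split=> //; first by move=> i j _ _ [y [/= <- <-]].
  by apply/seteqP; split=> // y _; exists (p y).
have /choice[p Pp] : forall y, exists i, P i y.
  move=> y; have [i _ Piy] : (\bigcup_i P i) y by rewrite PT.
  by exists i.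
have PE : P = (fun i => p @^-1` [set i]).
  apply/funext => i; apply/seteqP; split=> [y Piy|y <-]; last exact: Pp.
  by apply: tP => //; exists y; split=> //; exact: Pp.
by exists p; split=> // i; have := mP i; rewrite {1}PE.
Qed.

Variable mu : bprob X.

Lemma join_entropyE k (p : X -> 'I_k) n :
  join_entropy T mu (fun i => p @^-1` [set i]) n = entropy (word_prob T p mu (n := n)).
Proof.
rewrite /join_entropy /entropy; congr (- _); apply: eq_bigr => w _.
by rewrite /word_prob itin_preimage.
Qed.

Lemma partition_entropyE k (p : X -> 'I_k) :
  partition_entropy T mu (fun i => p @^-1` [set i]) =
  limn (fun n => entropy (word_prob T p mu (n := n)) / n%:R).
Proof.
rewrite /partition_entropy; suff -> : (fun n => join_entropy T mu
    (fun i => p @^-1` [set i]) n / n%:R) =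
    (fun n => entropy (word_prob T p mu (n := n)) / n%:R) by [].
by apply/funext => n; rewrite join_entropyE.
Qed.

Lemma le_metric_entropy k (p : X -> 'I_k) :
  (forall i, measurable (p @^-1` [set i] : set (borel X))) ->
  ((limn (fun n => entropy (word_prob T p mu (n := n)) / n%:R))%:E <=
   metric_entropy T mu)%E.
Proof.
move=> mp; apply: ereal_sup_ubound; exists k, (fun i => p @^-1` [set i]).
split; first by apply/is_partitionP; exists p.
by rewrite partition_entropyE.
Qed.

Lemma metric_entropy_le (M : \bar R) :
  (forall k (p : X -> 'I_k),
    (forall i, measurable (p @^-1` [set i] : set (borel X))) ->
    ((limn (fun n => entropy (word_prob T p mu (n := n)) / n%:R))%:E <= M)%E) ->
  (metric_entropy T mu <= M)%E.
Proof.
move=> H; apply: ge_ereal_sup => _ [k [P [/is_partitionP[p [-> mp]] ->]]].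
by rewrite partition_entropyE; exact: H.
Qed.

Lemma metric_entropy_ge0 : continuous T -> invariant_measures T mu ->
  (0 <= metric_entropy T mu)%E.
Proof.
move=> cT mu_inv; pose p (_ : X) : 'I_1 := ord0.
have mp i : measurable (p @^-1` [set i] : set (borel X)).
  suff -> : p @^-1` [set i] = setT by exact: measurableT.
  by apply/seteqP; split=> // y _ /=; rewrite [i]ord1.
apply: le_trans (le_metric_entropy mp); rewrite lee_fin; apply: limr_ge.
  exact: word_entropy_cvg.
apply: nearW => n; rewrite divr_ge0// entropy_ge0// => w; exact: word_prob01.
Qed.

End partitions.

(** * Coding typical orbits *)

Section spheres.
Context {R : realType} {X : pmetricType R}.
Implicit Types (c y : X) (r : R).

Lemma open_mdist_lt c r : open [set y | mdist c y < r].
Proof.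
rewrite openE => y /= cy; rewrite /interior; apply/nbhs_ballP.
exists (r - mdist c y) => [|z]; first by rewrite /= subr_gt0.
rewrite ballEmdist/= ltrBrDl; apply: le_lt_trans; exact: metric_triangle.
Qed.

Lemma open_mdist_gt c r : open [set y | r < mdist c y].
Proof.
rewrite openE => y /= cy; rewrite /interior; apply/nbhs_ballP.
exists (mdist c y - r) => [|z]; first by rewrite /= subr_gt0.
rewrite ballEmdist/= => yz; have := metric_triangle c z y.
rewrite (metric_sym z y); lra.
Qed.

Lemma closed_mdist_le c r : closed [set y | mdist c y <= r].
Proof.
rewrite (_ : mkset _ = ~` [set y | r < mdist c y]).
  exact/open_closedC/open_mdist_gt.
by apply/seteqP; split=> y /=; rewrite leNgt => /negP.
Qed.

Lemma closed_mdist_ge c r : closed [set y | r <= mdist c y].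
Proof.
rewrite (_ : mkset _ = ~` [set y | mdist c y < r]).
  exact/open_closedC/open_mdist_lt.
by apply/seteqP; split=> y /=; rewrite leNgt => /negP.
Qed.

Lemma closed_mdist_eq c r : closed [set y | mdist c y = r].
Proof.
rewrite (_ : mkset _ = [set y | mdist c y <= r] `&` [set y | r <= mdist c y]).
  by apply: closedI; [exact: closed_mdist_le|exact: closed_mdist_ge].
apply/seteqP; split=> y /=; first by move=> ->.
by move=> [? ?]; apply/eqP; rewrite eq_le; apply/andP.
Qed.

(** The mass [F r] of the closed ball of radius [r] is monotone in [r], hence has countably many
    discontinuities. At a continuity point the sphere is null, since its mass is at most the jump of
    [F]. *)
Lemma null_sphere (mu : probability (borel X) R) c (a b : R) : a < b ->
  exists r, a < r < b /\ mu [set y | mdist c y = r] = 0%E.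
Proof.
move=> ab; pose F r := fine (mu [set y | mdist c y <= r]).
have mF r : measurable ([set y | mdist c y <= r] : set (borel X)).
  by apply: closed_borel; exact: closed_mdist_le.
have ndF : {homo F : r s / r <= s}.
  move=> r s rs; apply: fine_le_borel => // y /= /le_trans; exact.
have F01 r : 0 <= F r <= 1 by exact: fine_borel01.
have Fl r : cvg (F x @[x --> r^'-]).
  apply: nondecreasing_at_left_is_cvgr; apply: nearW => x.
    by move=> ? ? _ _; exact: ndF.
  by exists 1 => _ [s _ <-]; have /andP[] := F01 s.
have Fr r : cvg (F x @[x --> r^'+]).
  apply: nondecreasing_at_right_is_cvgr; apply: nearW => x.
    by move=> ? ? _ _; exact: ndF.
  by exists 0 => _ [s _ <-]; have /andP[] := F01 s.
have [r [rab Fc]] : exists r, (r \in `]a, b[) /\ ~ discontinuity F r.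
  apply: contrapT => /forallNP H.
  (* If every radius were a discontinuity, the interval would be countable, against its positive
     Lebesgue measure. *)
  have : countable [set r | (r \in `]a, b[) /\ discontinuity F r].
    by apply: discontinuity_countable => ? ? _ _; exact: ndF.
  rewrite (_ : mkset _ = `]a, b[%classic); last first.
    apply/seteqP; split=> [r []//|r rab]; split=> //.
    by have /not_andP[//|/contrapT] := H r.
  move=> /countable_lebesgue_measure0; rewrite lebesgue_measure_itv/= lte_fin ab.
  by move=> -[] /eqP; rewrite subr_eq0 gt_eqF.
exists r; split; first by move: rab; rewrite in_itv.
have lim_eq : lim (F x @[x --> r^'-]) = lim (F x @[x --> r^'+]).
  by apply/eqP; apply/negP => /negP lr; apply: Fc; split.
have mS : measurable ([set y | mdist c y = r] : set (borel X)).
  by apply: closed_borel; exact: closed_mdist_eq.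
rewrite -fine_borel//; congr (_%:E); apply/eqP; rewrite eq_le.
have /andP[-> _] := fine_borel01 mu mS; rewrite andbT.
apply/ler_addgt0Pr => e e0; rewrite add0r.
have e20 : 0 < e / 2 by rewrite divr_gt0.
set l := lim (F x @[x --> r^'-]) in lim_eq.
have [s [sr Fs]] : exists s, s < r /\ l - e / 2 < F s.
  near r^'- => s; exists s; split; near: s; first exact: nbhs_left_lt.
  by apply: (cvgr_gt l); [exact: Fl|rewrite ltrBlDr ltrDl].
have [t [rt Ft]] : exists t, r < t /\ F t < l + e / 2.
  near r^'+ => t; exists t; split; near: t; first exact: nbhs_right_gt.
  by rewrite lim_eq; apply: cvgr_lt; [exact: Fr|rewrite ltrDl].
suff : fine (mu [set y | mdist c y = r]) + F s <= F t by lra.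
rewrite -lee_fin EFinD !fine_borel// -measureU//.
  rewrite le_measure ?inE//; first exact: measurableU.
  by move=> y /= [->|ys]; [exact: ltW|apply: le_trans ys _; lra].
by apply/seteqP; split=> // y /= [-> ]; rewrite leNgt sr.
Unshelve. all: by end_near. Qed.

End spheres.

Section itinerary_codes.
Context {R : realType} {X : pmetricType R}.
Variables (T : X -> X) (cT : continuous T).

Definition freq (x : X) n (A : set X) : R :=
  n%:R^-1 * \sum_(j < n) \1_A (iter j T x).

(* What the proof retains of weak-* accumulation: by the portmanteau theorem
   every mu in Mlim T x has this property. *)
Definition dominates (x : X) (mu : bprob X) := forall (I : finType) (F : I -> set X),
  (forall i, closed (F i)) -> forall d, 0 < d -> forall N, exists n,
  [/\ (N <= n)%N, (0 < n)%N &
      forall i, freq x n (F i) <= fine (mu (F i)) + d].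

Lemma closed_preimage_iter n (A : set X) : closed A -> closed (iter n T @^-1` A).
Proof.
elim: n => // n IH cA; have := IH cA => cnA.
rewrite (_ : _ @^-1` _ = T @^-1` (iter n T @^-1` A)); last first.
  by apply/seteqP; split=> y /=; rewrite -iterSr.
by apply: preimage_closed => // y _; exact: cT.
Qed.

(** Each point is labelled by the first open ball that contains it, with radii in []e, 2 * e[] whose
    spheres are null. The complements of the earlier balls are closed already, so passing to [F i]
    adds to a cell only points of one sphere. *)
Lemma closed_partition (mu : probability (borel X) R) k (c : 'I_k -> X) (e : R) :
  0 < e -> (forall y, exists i, mdist (c i) y < e) ->
  exists (p : X -> 'I_k) (F : 'I_k -> set X),
  [/\ forall y, mdist y (c (p y)) <= 2 * e,
      forall i, measurable (p @^-1` [set i] : set (borel X)),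
      forall i, closed (F i),
      forall i, p @^-1` [set i] `<=` F i &
      forall i, mu (F i `\` p @^-1` [set i]) = 0%E].
Proof.
move=> e0 ce.
have /choice[r r_] : forall i, exists r, e < r < 2 * e /\
    mu [set y | mdist (c i) y = r] = 0%E.
  by move=> i; apply: null_sphere; rewrite mulr_natl mulr2n ltrDl.
pose D i := [set y | mdist (c i) y < r i] `&`
  \bigcap_(j in [set j : 'I_k | (j < i)%N]) [set y | r j <= mdist (c j) y].
pose F i := [set y | mdist (c i) y <= r i] `&`
  \bigcap_(j in [set j : 'I_k | (j < i)%N]) [set y | r j <= mdist (c j) y].
have /choice[p pD] : forall y, exists i, D i y.
  move=> y; have [i0 ci0] := ce y.
  have i0r : mdist (c i0) y < r i0.
    by have [/andP[er _] _] := r_ i0; exact: lt_trans er.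
  pose i := [arg min_(i < i0 | mdist (c i) y < r i) (i : nat)].
  exists i; rewrite /i; case: arg_minnP => // {}i ir mini; split=> // j /= ji.
  by rewrite leNgt; apply/negP => /mini; rewrite leqNgt ji.
have Dp i y : D i y -> p y = i.
  move=> [/= Di1 Di2]; have [/= pD1 pD2] := pD y.
  apply/val_inj/eqP; rewrite eqn_leq; apply/andP; split;
    rewrite leqNgt; apply/negP => ji.
    by have := pD2 _ ji; rewrite /= leNgt Di1.
  by have := Di2 _ ji; rewrite /= leNgt pD1.
have pE i : p @^-1` [set i] = D i.
  by apply/seteqP; split=> y; [move=> /= <-|exact: Dp].
have cI i : closed (\bigcap_(j in [set j : 'I_k | (j < i)%N])
    [set y | r j <= mdist (c j) y]).
  by apply: closed_bigI => j _; exact: closed_mdist_ge.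
have cF i : closed (F i) by apply: closedI => //; exact: closed_mdist_le.
have mD i : measurable (D i : set (borel X)).
  apply: measurableI; last by apply: closed_borel; exact: cI.
  by apply: open_borel; exact: open_mdist_lt.
exists p, F; split=> // [y|i|i|i]; rewrite ?pE//.
- rewrite metric_sym; have [/ltW + _] := pD y; move=> /le_trans; apply.
  by have [/andP[_ /ltW]] := r_ (p y).
- by move=> y [/= yr yI]; split=> //; exact: ltW.
- apply: (@subset_measure0 _ _ _ mu _ [set y | mdist (c i) y = r i]).
  + by apply: measurableD => //; apply: closed_borel; exact: cF.
  + by apply: closed_borel; exact: closed_mdist_eq.
  + move=> y [[/= yr yI] nD]; apply/eqP; rewrite eq_le yr/= leNgt; apply/negP => yr'.
    by apply: nD.
  + by have [_] := r_ i.
Qed.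

(** The code is fitted to the [m]-words of [mu]. Each word cylinder lies in a closed set of the same
    measure, where domination bounds its frequency along the orbit of [x], and hence the mean code
    length. *)
Lemma often_coded_dominates x (mu : bprob X) k (c : 'I_k -> X) (e h h' : R) :
  invariant_measures T mu -> dominates x mu -> (metric_entropy T mu <= h%:E)%E ->
  h < h' -> 0 < e -> (forall y, exists i, mdist (c i) y < e) ->
  exists m (a : {ffun {ffun 'I_m -> 'I_k} -> nat}),
    (0 < m)%N /\ often_coded T c (2 * e) h' (count_code (R := R) a) x.
Proof.
move=> mu_inv dom hh hh' e0 ce.
have [p [F [pe mp cF pF F0]]] := closed_partition mu e0 ce.
(* One third each for the block entropy, the code and the frequencies. *)
pose d := (h' - h) / 3%:R.
have d0 : 0 < d by rewrite divr_gt0// subr_gt0.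
pose pr m := word_prob T p mu (n := m).
have [m m0 Hm] : exists2 m, (0 < m)%N & entropy (pr m) <= m%:R * (h + d).
  have lim_h : limn (fun n => entropy (pr n) / n%:R) <= h.
    by rewrite -lee_fin; exact: le_trans (le_metric_entropy T mu mp) hh.
  near \oo => m; have m0 : (0 < m)%N by near: m; exact: nbhs_infty_gt.
  exists m => //; rewrite mulrC -ler_pdivrMr ?ltr0n//; apply: ltW; near: m.
  apply: (cvgr_lt _ (word_entropy_cvg cT mp mu_inv)).
  by apply: le_lt_trans lim_h _; rewrite ltrDl.
have p1 := sum_word_prob cT mp mu m.
have [a La] := count_code_approx d0 (word_prob_ge0 T p mu (n := m)) p1.
pose L w : R := count_code a w.
have L0 w : 0 <= L w by exact: count_code_ge0.
exists m, a; split=> //; apply: (@often_codedP _ _ T k m c _ h' _ m0 p) => // N.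
pose G (w : {ffun 'I_m -> 'I_k}) := \bigcap_(l : 'I_m) (iter l T @^-1` (F (w l))).
have cG w : closed (G w) by apply: closed_bigI => l _; exact: closed_preimage_iter.
have mI (w : {ffun 'I_m -> 'I_k}) := itin_measurable cT mp (n := m) w.
have sub w : itin T p m @^-1` [set w] `<=` G w.
  by move=> y <- l _; apply: pF; rewrite /= ffunE.
have Gpr w : fine (mu (G w)) <= pr m w.
  have mG := closed_borel (cG w).
  (* A point of [G w] outside the cylinder of [w] has a wrong letter at some position [l], so its
     [l]-th iterate lies in a null part of [F (w l)]. By invariance the preimages of these parts are
     null as well. *)
  pose Z l := if insub l is Some l' then
    iter l T @^-1` (F (w l') `\` p @^-1` [set w l']) else set0.
  have mZ l : measurable (Z l : set (borel X)).
    rewrite /Z; case: insubP => // l' _ _; apply: iter_preimage_measurable => //.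
    by apply: measurableD => //; apply: closed_borel; exact: cF.
  have muZ l : mu (Z l) = 0%E.
    rewrite /Z; case: insubP => [l' _ _|]; last by rewrite measure0.
    rewrite (iter_invariant cT mu_inv) ?F0//.
    by apply: measurableD => //; apply: closed_borel; exact: cF.
  have mUZ : measurable (\big[setU/set0]_(l < m) Z l : set (borel X)).
    exact: bigsetU_measurable.
  have GZ : G w `<=` itin T p m @^-1` [set w] `|` \big[setU/set0]_(l < m) Z l.
    move=> y Gy; have [yw|yw] := pselect (itin T p m y = w); [by left|right].
    rewrite -bigcup_mkord; have [l wl] : exists l : 'I_m, p (iter l T y) <> w l.
      apply: contrapT => /forallNP H; apply: yw; apply/ffunP => l; rewrite ffunE.
      by apply: contrapT; exact: H.
    exists (val l); first exact: ltn_ord.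
    by rewrite /Z valK; split=> //; exact: Gy.
  rewrite -lee_fin !fine_borel//.
  apply: (@le_trans _ _ (mu (itin T p m @^-1` [set w] `|`
                             \big[setU/set0]_(l < m) Z l))).
    by rewrite le_measure ?inE//; exact: measurableU.
  apply: (le_trans (measureU2 mu (mI w) mUZ)); rewrite -[leRHS]adde0 leeD2l//.
  have mZm l : (l < m)%N -> measurable (Z l : set (borel X)) by [].
  by apply: (le_trans (Boole_inequality mu mZm)); rewrite big1// => l _; exact: muZ.
(* Makes the total frequency error [d' * \sum_w L w] at most [d]; the 1 keeps the denominator
   positive. *)
pose d' := d / (1 + \sum_w L w).
have SL : 0 <= \sum_w L w by rewrite sumr_ge0.
have d'0 : 0 < d' by rewrite divr_gt0// ltr_wpDr.
have [n [Nn n0 nG]] := dom _ G cG d' d'0 N.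
exists n => //.
have -> : \sum_(j < n) L (itin T p m (iter j T x)) =
    \sum_w L w * \sum_(j < n) (itin T p m (iter j T x) == w)%:R.
  under [RHS]eq_bigr do rewrite mulr_sumr.
  rewrite exchange_big/=; apply: eq_bigr => j _.
  rewrite (bigD1 (itin T p m (iter j T x)))//= eqxx mulr1 big1 ?addr0// => w.
  by rewrite eq_sym => /negbTE ->; rewrite mulr0.
apply: (@le_trans _ _ (\sum_w L w * (n%:R * (pr m w + d')))).
  apply: ler_sum => w _; rewrite ler_wpM2l//.
  apply: (@le_trans _ _ (n%:R * freq x n (G w))).
    rewrite /freq mulVKf ?pnatr_eq0 -?lt0n//; apply: ler_sum => j _.
    have [jw|_] := eqVneq (itin T p m (iter j T x)) w; last by rewrite indicE ler0n.
    by rewrite indicE mem_set//; exact: sub.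
  by rewrite ler_pM2l ?ltr0n//; apply: le_trans (nG w) _; rewrite lerD2r.
have -> : \sum_w L w * (n%:R * (pr m w + d')) =
    n%:R * (\sum_w pr m w * L w + d' * \sum_w L w).
  rewrite mulrDr !mulr_sumr -big_split/=; apply: eq_bigr => w _; ring.
rewrite ler_pM2l ?ltr0n//.
have d'L : d' * \sum_w L w <= d.
  rewrite /d' mulrAC ler_pdivrMr ?ltr_wpDr// ler_pM2l// lerDr.
  exact: ler01.
have m1 : 1 <= m%:R :> R by rewrite ler1n.
have : h' = h + 3%:R * d by rewrite /d mulrC divfK ?pnatr_eq0// addrC subrK.
move=> ->; move: La Hm; rewrite -/L -/(pr m) => La Hm.
apply: (@le_trans _ _ (m%:R * (h + d) + d + d)); first lra.
rewrite !mulrDr; nra.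
Unshelve. all: by end_near. Qed.

End itinerary_codes.

(** * Bowen's upper bound for topological entropy *)

Section bowen_bound.
Context {R : realType} {X : pmetricType R}.

Lemma finite_net (e : R) : compact [set: X] -> 0 < e ->
  exists k (c : 'I_k -> X), forall y, exists i, mdist (c i) y < e.
Proof.
move=> cX e0; move: cX; rewrite compact_cover => cX.
have [||D _ XD] := cX X setT (fun x => [set y | mdist x y < e]).
- by move=> x _; exact: open_mdist_lt.
- by move=> y _; exists y => //=; rewrite mdistxx.
pose s := finmap.enum_fset D.
exists (size s), (fun i => nth point s i) => y.
have [x xD xy] := XD y Logic.I.
have xs : (index x s < size s)%N by rewrite index_mem.
by exists (Ordinal xs); rewrite /= nth_index.
Qed.

Variables (T : X -> X) (cT : continuous T) (cX : compact [set: X]).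

Lemma htop_le_entropy (E : set X) (S : \bar R) : (0 <= S)%E ->
  (forall x, E x -> exists mu : bprob X,
    [/\ invariant_measures T mu, dominates T x mu & (metric_entropy T mu <= S)%E]) ->
  (htop T E <= S)%E.
Proof.
case: S => [h|_ _|//]; last exact: leey.
rewrite lee_fin => h0 HE; apply/lee_addgt0Pr => d d0; rewrite -EFinD.
apply: htop_le_bowen_C => [|e e0]; first by rewrite addr_ge0// ltW.
have e40 : 0 < e / 4%:R by rewrite divr_gt0.
have [k [c ce]] := finite_net cX e40.
have k0 : (0 < k)%N by have [[i ik] _] := ce point; apply: leq_ltn_trans ik.
have d20 : 0 < d / 2 by rewrite divr_gt0.
(* [closed_partition] doubles the radius of the net, and centring Bowen balls inside the covered set
   doubles it again. *)
have -> : e = 2 * (2 * (e / 4%:R)) by field.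
apply: bowen_C_eq0 => n; apply/eqP; rewrite eq_le bowen_Cn_ge0 andbT.
(* The measure attached to a point enters only through a block length and a vector of counts, so a
   countable index serves all points of [E]. *)
pose I : countType := {m : nat & {ffun {ffun 'I_m -> 'I_k} -> nat}}.
pose G (ma : I) := if (0 < tag ma)%N then
  often_coded T c (2 * (e / 4%:R)) (h + d / 2)
    (count_code (R := R) (tagged ma)) else set0.
have EG : E `<=` [set x | exists ma, G ma x].
  move=> x /HE[mu [mu_inv dom hmu]].
  have [|m [a [m0 xa]]] :=
      often_coded_dominates cT mu_inv dom hmu _ e40 ce (h' := h + d / 2).
    by rewrite ltrDl.
  by exists (Tagged (fun m => {ffun {ffun 'I_m -> 'I_k} -> nat}) a); rewrite /G /= m0.
apply: (le_trans (le_bowen_Cn _ _ _ _ EG)).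
rewrite bowen_Cn_bigcup0// => -[m a]; rewrite /G/=; case: ifPn => [m0|_].
  apply: bowen_Cn_often_coded => //; last 2 first.
  - by rewrite addr_ge0// ltW.
  - by rewrite ltrD2l gtr_pMr// invf_lt1// ltr1n.
  - exact: count_code_kraft.
exact: bowen_Cn_set0.
Qed.

End bowen_bound.

(** * Limits of empirical measures *)

Section continuous_functions.
Context {R : realType} {X : pmetricType R}.
Implicit Types (mu : probability (borel X) R) (f : X -> R).

Lemma continuous_borel_fun f : continuous f ->
  measurable_fun [set: borel X] (f : borel X -> R).
Proof.
move=> cf; apply: (measurability _ (RGenOInfty.measurableE R)) => // _ [_ [a ->] <-].
by rewrite setTI; apply: open_borel; move/continuousP : cf; apply; exact: rray_open.
Qed.

Lemma continuous_integrable mu f : continuous f -> (forall y, 0 <= f y <= 1) ->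
  mu.-integrable [set: borel X] (EFin \o f).
Proof.
move=> cf f01; apply: measurable_bounded_integrable => //.
- by rewrite (le_lt_trans (probability_le1 _ _))// ltry.
- exact: continuous_borel_fun.
exists 1; split=> // M M1 y _ /=; have /andP[f0 f1] := f01 y.
by rewrite ger0_norm//; apply: le_trans f1 _; exact: ltW.
Qed.

Lemma measure_le_Rintegral mu f (A : set (borel X)) : continuous f ->
  (forall y, 0 <= f y <= 1) -> measurable A -> (forall y, A y -> f y = 1) ->
  fine (mu A) <= \int[mu]_y f y.
Proof.
move=> cf f01 mA Af; have f0 y : 0 <= f y by have /andP[] := f01 y.
rewrite -lee_fin fine_borel// /Rintegral fineK; last first.
  by apply: integrable_fin_num => //; exact: continuous_integrable.
rewrite -[in leLHS](setIT A) -integral_indic//; apply: ge0_le_integral => //.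
- by apply/measurable_EFinP; exact: measurable_indic.
- by apply/measurable_EFinP; exact: continuous_borel_fun.
- move=> y _; rewrite lee_fin indicE; case: (boolP (y \in A)) => // /set_mem/Af ->//.
Qed.

Lemma Rintegral_le_measure mu f (A : set (borel X)) : continuous f ->
  (forall y, 0 <= f y <= 1) -> measurable A -> (forall y, ~ A y -> f y = 0) ->
  \int[mu]_y f y <= fine (mu A).
Proof.
move=> cf f01 mA Af; have f0 y : 0 <= f y by have /andP[] := f01 y.
rewrite -lee_fin fine_borel// /Rintegral fineK; last first.
  by apply: integrable_fin_num => //; exact: continuous_integrable.
rewrite -[in leRHS](setIT A) -integral_indic//; apply: ge0_le_integral => //.
- by move=> y _; rewrite lee_fin.
- by apply/measurable_EFinP; exact: continuous_borel_fun.
- by apply/measurable_EFinP; exact: measurable_indic.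
- move=> y _; rewrite lee_fin indicE; case: (boolP (y \in A)) => [_|/negP yA].
    by have /andP[] := f01 y.
  by rewrite Af// => Ay; apply: yA; exact: mem_set.
Qed.

Lemma urysohn_closed_open (F U : set X) : closed F -> open U -> F `<=` U ->
  exists f : X -> R, [/\ continuous f, forall y, 0 <= f y <= 1,
    forall y, F y -> f y = 1 & forall y, ~ U y -> f y = 0].
Proof.
move=> cF oU FU; have nX : normal_space X by exact: (@pseudometric_normal R).
have [||f [cf fU fF f01]] := @urysohn_ext_itv _ R nX (~` U) F 0 1 _ cF _ ltr01.
- exact: open_closedC.
- by apply/seteqP; split=> // y [nUy /FU].
exists f; split=> // y.
- by have /(_ (f y)) := f01; rewrite /= in_itv/=; apply; exists y.
- by move=> Fy; apply: fF; exists y.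
- by move=> nUy; apply: fU; exists y.
Qed.

(** Metric neighbourhoods of [F] of radius [1 / n.+1] decrease to [F], and [mu] is continuous from
    above. The finite family [g] lets one [U] serve both [id] and [T] in the proof of invariance. *)
Lemma closed_outer_approx mu (I : finType) (g : I -> X -> X) (F : set X) (d : R) :
  (forall i, continuous (g i)) -> closed F -> 0 < d ->
  exists U, [/\ open U, F `<=` U &
    forall i, fine (mu (g i @^-1` U)) <= fine (mu (g i @^-1` F)) + d].
Proof.
move=> cg cF d0; pose U n := [set y | exists2 z, F z & mdist z y < n.+1%:R^-1].
have oU n : open (U n).
  rewrite (_ : U n = \bigcup_(z in F) [set y | mdist z y < n.+1%:R^-1]).
    by apply: bigcup_open => z _; exact: open_mdist_lt.
  by apply/seteqP; split=> y [z Fz zy]; exists z.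
have FU n : F `<=` U n by move=> y Fy; exists y => //; rewrite mdistxx.
have UF : \bigcap_n U n = F.
  apply/seteqP; split=> [y yU|y Fy n _]; last exact: FU.
  rewrite ((closure_id F).1 cF) => B /nbhs_ballP[e /= e0 eB].
  have [n ne] : exists n, n.+1%:R^-1 < e.
    by near \oo => n; exists n; near: n; exact: near_infty_natSinv_lt (PosNum e0).
  have [z Fz zy] := yU n Logic.I; exists z; split=> //; apply: eB.
  by rewrite ballEmdist/= metric_sym; exact: lt_trans ne.
have mU i n := borel_preimage (cg i) (open_borel (oU n)).
have mF i := borel_preimage (cg i) (closed_borel cF).
have cvgU i : fine (mu (g i @^-1` U n)) @[n --> \oo] --> fine (mu (g i @^-1` F)).
  apply: fine_cvg; rewrite fine_borel// -UF preimage_bigcap.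
  apply: nonincreasing_cvg_mu => //.
  - by rewrite (le_lt_trans (probability_le1 _ _))// ltry.
  - by rewrite -preimage_bigcap UF.
  - move=> n m nm; apply/subsetPset => y [z Fz zy]; exists z => //.
    apply: lt_le_trans zy _; rewrite lef_pV2 ?posrE ?ltr0n// ler_nat.
    by rewrite ltnS.
have : \forall n \near \oo, forall i,
    fine (mu (g i @^-1` U n)) <= fine (mu (g i @^-1` F)) + d.
  apply: filter_forall => i; apply: (cvgr_le _ (cvgU i)).
  by rewrite ltrDl.
by move=> [n _ /(_ n (leqnn _))] H; exists (U n).
Unshelve. all: by end_near. Qed.

End continuous_functions.

Section empirical_measures.
Context {R : realType} {X : pmetricType R}.
Variables (T : X -> X).

Lemma empiricalE x n (A : set (borel X)) : measurable A ->
  empirical T x n A = (freq T x n.+1 A)%:E.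
Proof.
move=> mA; rewrite /= brestrE// /emp_fun /mscale/= /msum /freq EFinM -sumEFin.
by [].
Qed.

Lemma empirical_Rintegral x n (f : X -> R) : continuous f ->
  (forall y, 0 <= f y <= 1) ->
  \int[empirical T x n]_y f y = n.+1%:R^-1 * \sum_(j < n.+1) f (iter j T x).
Proof.
move=> cf f01; have f0 y : 0 <= f y by have /andP[] := f01 y.
have mf : measurable_fun [set: borel X] (EFin \o (f : borel X -> R)).
  by apply/measurable_EFinP; exact: continuous_borel_fun.
rewrite /Rintegral (@eq_measure_integral _ _ _ setT (emp_fun T x n)); last first.
  by move=> A mA _; exact: brestrE.
rewrite ge0_integral_mscale//=; last by move=> y _; rewrite lee_fin.
have E : (\int[msum (fun j => dirac (iter j T x : borel X)) n.+1]_y (f y)%:E =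
    \sum_(j < n.+1) \int[dirac (iter j T x : borel X)]_y (f y)%:E)%E.
  by apply: ge0_integral_measure_sum => // y _; rewrite lee_fin.
rewrite [X in (_ * X)%E](_ : _ = (\sum_(j < n.+1) (f (iter j T x))%:E)%E).
  by rewrite sumEFin -EFinM.
apply: (eq_trans E); apply: eq_bigr => j _.
by rewrite integral_dirac// diracT mul1e.
Qed.

(** Finitely many test functions define a weak-* neighbourhood of [mu], which the empirical measures
    visit at arbitrarily late times. *)
Lemma Mlim_near x (mu : bprob X) (I : finType) (f : I -> X -> R) (d : R) N :
  Mlim T x mu -> (forall i, continuous (f i)) -> 0 < d ->
  exists2 n, (N <= n)%N &
    forall i, `|\int[mu]_y f i y - \int[empirical T x n]_y f i y| < d.
Proof.
move=> xmu cf d0.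
pose B := [set nu : bprob X | forall i, `|\int[mu]_y f i y - \int[nu]_y f i y| < d].
have Bmu : \forall nu \near mu, forall i,
    `|\int[mu]_y f i y - \int[nu : bprob X]_y f i y| < d.
  have FF : Filter (nbhs mu) by exact: nbhs_filter.
  apply: (@filter_forall _ I (fun i (nu : bprob X) =>
    `|\int[mu]_y f i y - \int[nu]_y f i y| < d) _ FF) => i.
  have ci : {for mu, continuous (fun nu : bprob X => wstar_eval nu (mkcts (@cf i)))}.
    apply: (@continuous_comp _ _ _ (@wstar_eval R X)
      (fun g : {ptws continuousType X R -> R} => g (mkcts (@cf i)))).
      exact: (@initial_continuous _ _ (@wstar_eval R X)).
    exact: (@proj_continuous _ (fun=> R)).
  by move: ci => /cvgrPdist_lt/(_ d d0).
have := xmu _ B _ Bmu; move=> /(_ (empirical T x @` [set n | (N <= n)%N]))[].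
  by exists N => // n /= Nn; exists n.
by move=> _ [[n Nn <-] Bn]; exists n.
Qed.

Hypothesis cT : continuous T.

Lemma Mlim_dominates x (mu : bprob X) : Mlim T x mu -> dominates T x mu.
Proof.
move=> xmu I F cF d d0 N; have d20 : 0 < d / 2 by rewrite divr_gt0.
have /choice[f fP] i : exists f : X -> R, [/\ continuous f,
    forall y, 0 <= f y <= 1, forall y, F i y -> f y = 1 &
    \int[mu]_y f y <= fine (mu (F i)) + d / 2].
  have [|U [oU FU /(_ tt) muU]] :=
    @closed_outer_approx _ _ mu unit (fun=> id) (F i) _ _ (cF i) d20.
    by move=> _ y; exact: cvg_id.
  have [f [cf f01 fF fU]] := urysohn_closed_open (cF i) oU FU.
  exists f; split=> //; apply: le_trans muU.
  by apply: Rintegral_le_measure => //; exact: open_borel.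
have [|n Nn H] := @Mlim_near x mu I f (d / 2) N xmu _ d20.
  by move=> i; have [] := fP i.
(* [empirical T x n] averages over [n.+1] points. *)
exists n.+1; split=> [||i]; [exact: leqW| by []|].
have [cf f01 fF muf] := fP i; have mF := closed_borel (cF i).
apply: (@le_trans _ _ (\int[empirical T x n]_y f i y)).
  have := measure_le_Rintegral (empirical T x n) cf f01 mF fF.
  by rewrite [X in fine X](empiricalE x n mF).
have := H i; rewrite ltr_norml => /andP[]; lra.
Qed.

(** The Krylov-Bogolyubov argument: under an empirical measure the two integrals differ by a
    telescoping sum, at most [1 / n.+1] for [f] with values in [[0, 1]]. *)
Lemma Mlim_Rintegral x (mu : bprob X) (f : X -> R) : Mlim T x mu -> continuous f ->
  (forall y, 0 <= f y <= 1) -> \int[mu]_y f (T y) = \int[mu]_y f y.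
Proof.
move=> xmu cf f01.
have cfT : continuous (f \o T).
  by move=> y; apply: continuous_comp; [exact: cT|exact: cf].
have f0 y : 0 <= f y by have /andP[] := f01 y.
have f1 y : f y <= 1 by have /andP[] := f01 y.
apply/eqP; rewrite -subr_eq0 -normr_le0; apply/ler_addgt0Pr => d d0; rewrite add0r.
have d30 : 0 < d / 3%:R by rewrite divr_gt0.
have f01T y : 0 <= (f \o T) y <= 1 by exact: f01.
pose g (b : bool) := if b then f else f \o T.
have cg b : continuous (g b) by case: b.
have [N Nd] : exists N, forall n, (N <= n)%N -> n.+1%:R^-1 < d / 3%:R.
  by have [N _ H] := near_infty_natSinv_lt (PosNum d30); exists N => n Nn; exact: H.
have [n Nn H] := Mlim_near N xmu cg d30.
have Ht : `|\int[mu]_y f y - \int[empirical T x n]_y f y| < d / 3%:R := H true.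
have Hf : `|\int[mu]_y f (T y) - \int[empirical T x n]_y f (T y)| < d / 3%:R :=
  H false.
have : `|\int[empirical T x n]_y f (T y) - \int[empirical T x n]_y f y| <= d / 3%:R.
  rewrite (empirical_Rintegral x n cf f01) (empirical_Rintegral x n cfT f01T).
  rewrite -mulrBr -sumrB.
  rewrite (eq_bigr (fun j : 'I_n.+1 => f (iter j.+1 T x) - f (iter j T x)))//.
  rewrite -(big_mkord xpredT (fun j => f (iter j.+1 T x) - f (iter j T x))).
  rewrite (telescope_sumr (fun j => f (iter j T x)))// normrM.
  apply: le_trans (ltW (Nd n Nn)).
  rewrite [X in X * _]ger0_norm ?invr_ge0// ger_pMr ?invr_gt0 ?ltr0n//.
  rewrite ler_norml; have := f0 x; have := f1 x.
  have := f0 (iter n.+1 T x); have := f1 (iter n.+1 T x) => /=; lra.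
move: Ht Hf; rewrite !ltr_norml !ler_norml => /andP[? ?] /andP[? ?] /andP[? ?].
by apply/andP; split; lra.
Qed.

Lemma closed_sets_generate :
  (@open X).-sigma.-measurable = <<s @closed X >> :> set (set (borel X)).
Proof.
apply/seteqP; split=> A.
  apply: smallest_sub; first exact: smallest_sigma_algebra.
  move=> U oU; rewrite -[U]setCK.
  have [_ + _] := smallest_sigma_algebra setT (@closed X).
  rewrite -setTD; apply.
  by apply: sub_sigma_algebra; exact: open_closedC.
by apply: smallest_sub; [exact: sigma_algebra_measurable|move=> F; exact: closed_borel].
Qed.

(** Urysohn functions carry the equality of integrals over to closed sets; these are stable under
    intersection and generate the Borel sets, so the two measures agree. *)
Lemma Mlim_invariant x (mu : bprob X) : Mlim T x mu -> invariant_measures T mu.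
Proof.
move=> xmu.
have mT : measurable_fun [set: borel X] (T : borel X -> borel X).
  by move=> _ A mA; rewrite setTI; exact: borel_preimage.
suff H (F : set (borel X)) : closed (F : set X) -> mu (T @^-1` F) = mu F.
  move=> A mA; pose TX : borel X -> borel X := T.
  have := @measure_unique _ R (borel X) (@closed X) (fun=> setT)
    closed_sets_generate _ _ _ (pushforward mu TX) mu.
  apply => //.
  - by move=> B C cB cC; exact: closedI.
  - by apply/seteqP; split=> // y _; exists 0.
  - by move=> _; exact: (le_lt_trans (probability_le1 mu measurableT) (ltry 1)).
move=> cF; have mF := closed_borel cF; have mTF := borel_preimage cT mF.
suff H d : 0 < d -> fine (mu (T @^-1` F)) <= fine (mu F) + d /\
    fine (mu F) <= fine (mu (T @^-1` F)) + d.
  rewrite -(fine_borel mu mF) -(fine_borel mu mTF); congr (_%:E).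
  by apply/eqP; rewrite eq_le; apply/andP; split; apply/ler_addgt0Pr => d /H[].
move=> d0; pose g (b : bool) := if b then T else id.
have cg b : continuous (g b) by case: b => // y; exact: cvg_id.
have [U [oU FU muU]] := closed_outer_approx mu cg cF d0.
have [f [cf f01 fF fU]] := urysohn_closed_open cF oU FU.
have cfT : continuous (f \o T).
  by move=> y; apply: continuous_comp; [exact: cT|exact: cf].
have fT := Mlim_Rintegral xmu cf f01.
have mU := open_borel oU; have mTU := borel_preimage cT mU.
split.
  apply: le_trans (muU false).
  apply: (@le_trans _ _ (\int[mu]_y f (T y))).
    by apply: (@measure_le_Rintegral _ _ mu (f \o T)) => // y; [exact: f01|exact: fF].
  by rewrite fT; exact: Rintegral_le_measure.
apply: le_trans (muU true).
apply: (@le_trans _ _ (\int[mu]_y f y)); first exact: measure_le_Rintegral.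
by rewrite -fT; apply: (@Rintegral_le_measure _ _ mu (f \o T)) => // y;
  [exact: f01|exact: fU].
Qed.

End empirical_measures.

(** * Regularization of a content *)

Section content_regularization.
Context {R : realType} {X : pmetricType R}.
Hypothesis cX : compact [set: X].
Variable m : set X -> R.
Hypothesis m_ge0 : forall A, 0 <= m A.
Hypothesis mU : forall A B, A `&` B = set0 -> m (A `|` B) = m A + m B.
Hypothesis mT : m setT = 1.

Lemma le_content A B : A `<=` B -> m A <= m B.
Proof.
move=> AB; rewrite -(setDUK AB) mU ?lerDl//.
by apply/seteqP; split=> // y [? []].
Qed.

Lemma content_setU_le A B : m (A `|` B) <= m A + m B.
Proof.
rewrite -(setDUK (@subsetUl _ A B)) mU; last by apply/seteqP; split=> // y [? []].
by rewrite lerD2l; apply: le_content => y [[]].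
Qed.

Lemma content0 : m set0 = 0.
Proof. by have := @mU set0 set0; rewrite setI0 setU0 => /(_ erefl); lra. Qed.

Lemma content_le1 A : m A <= 1.
Proof. by rewrite -mT; exact: le_content. Qed.

Local Open Scope ereal_scope.

(** Meant for open [U]. Together with [outer] it is the classical passage from a content to a
    regular Borel measure. *)
Definition inner (U : set X) : \bar R :=
  ereal_sup [set (m K)%:E | K in [set K | closed K /\ K `<=` U]].

Lemma inner_ge K U : closed K -> K `<=` U -> (m K)%:E <= inner U.
Proof. by move=> cK KU; apply: ereal_sup_ubound; exists K. Qed.

Lemma inner_ge0 U : 0 <= inner U.
Proof. by rewrite -[0]/(0%R%:E) -content0; apply: inner_ge => //; exact: closed0. Qed.

Lemma inner_le1 U : inner U <= 1.
Proof. by apply: ge_ereal_sup => _ [K _ <-]; rewrite lee_fin content_le1. Qed.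

Lemma le_inner U V : U `<=` V -> inner U <= inner V.
Proof.
move=> UV; apply: ge_ereal_sup => _ [K [cK KU] <-].
by apply: inner_ge => //; exact: subset_trans KU UV.
Qed.

(** A closed [K] inside the union is cut at level 1/2 of a Urysohn function equal to 1 on [K] minus
    [V] and to 0 off [U]: the upper part lies in [U], the lower part in [V]. *)
Lemma innerU U V : open U -> open V -> inner (U `|` V) <= inner U + inner V.
Proof.
move=> oU oV; apply: ge_ereal_sup => _ [K [cK KUV] <-].
have cKV : closed (K `&` ~` V) by apply: closedI => //; exact: open_closedC.
have [|f [cf f01 fK fU]] := urysohn_closed_open cKV oU.
  by move=> y [/KUV[]].
pose K1 := K `&` f @^-1` [set r | (2^-1 <= r)%R].
pose K2 := K `&` f @^-1` [set r | (r <= 2^-1)%R].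
have K12 : K `<=` K1 `|` K2.
  by move=> y Ky; have [?|/ltW ?] := leP 2^-1%R (f y); [left|right].
apply: (@le_trans _ _ (m K1 + m K2)%:E).
  by rewrite lee_fin; apply: le_trans (content_setU_le _ _); exact: le_content.
rewrite EFinD; apply: leeD; apply: inner_ge.
- apply: closedI => //.
  by apply: preimage_closed => [y _|]; [exact: cf|exact: closed_ge].
- move=> y [Ky /= fy]; apply: contrapT => /fU fy0; move: fy; rewrite fy0 leNgt.
  by rewrite invr_gt0 ltr0n.
- apply: closedI => //.
  by apply: preimage_closed => [y _|]; [exact: cf|exact: closed_le].
- move=> y [Ky /= fy]; apply: contrapT => nVy.
  by move: fy; rewrite fK// leNgt invf_lt1// ltr1n.
Qed.

(** Countable subadditivity comes from compactness alone: [m] is only finitely additive, but a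
    closed [K] meets finitely many [U n] of a subcover. *)
Lemma inner_bigcup (U : (set X)^nat) : (forall n, open (U n)) ->
  inner (\bigcup_n U n) <= \sum_(n <oo) inner (U n).
Proof.
move=> oU; apply: ge_ereal_sup => _ [K [cK KU] <-].
have : compact K by exact: subclosed_compact cK cX _.
rewrite compact_cover => /(_ nat setT U (fun n _ => oU n) KU)[D _ KD].
have [N DN] : exists N, forall n, n \in D -> (n < N)%N.
  exists (\max_(n <- finmap.enum_fset D) n).+1 => n nD.
  by rewrite ltnS; exact: leq_bigmax_seq.
have H n : inner (\big[setU/set0]_(i < n) U i) <= \sum_(i < n) inner (U i).
  elim: n => [|n IH].
    rewrite !big_ord0; apply: ge_ereal_sup => _ [L [_ L0] <-].
    by rewrite lee_fin -content0; exact: le_content.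
  rewrite !big_ord_recr/=; apply: le_trans (leeD IH (lexx _)).
  by apply: innerU => //; rewrite -bigcup_mkord; exact: bigcup_open.
apply: (@le_trans _ _ (inner (\big[setU/set0]_(i < N) U i))).
  apply: inner_ge => // y /KD[n nD Uny]; rewrite -bigcup_mkord.
  by exists n => //; exact: DN.
apply: le_trans (H N) _; rewrite -(big_mkord xpredT (fun i => inner (U i))).
by apply: nneseries_lim_ge => n _ _; exact: inner_ge0.
Qed.

Lemma inner_setD K V : closed K -> K `<=` V ->
  (m K)%:E + inner (V `\` K) <= inner V.
Proof.
move=> cK KV; rewrite addeC -leeBrDr//; apply: ge_ereal_sup => _ [L [cL LVK] <-].
rewrite leeBrDr// -EFinD -mU; last first.
  by apply/seteqP; split=> // y [/LVK[]].
by apply: inner_ge; [exact: closedU|move=> y [/LVK[]|/KV]].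
Qed.

Definition outer (E : set X) : \bar R :=
  ereal_inf [set inner U | U in [set U | open U /\ E `<=` U]].

Lemma outer_ge0 E : 0 <= outer E.
Proof. by apply: le_ereal_inf_tmp => _ [U _ <-]; exact: inner_ge0. Qed.

Lemma outer_le E U : open U -> E `<=` U -> outer E <= inner U.
Proof. by move=> oU EU; apply: ereal_inf_lbound; exists U. Qed.

Lemma outer_open U : open U -> outer U = inner U.
Proof.
move=> oU; apply/eqP; rewrite eq_le outer_le//=.
by apply: le_ereal_inf_tmp => _ [V [_ UV] <-]; exact: le_inner.
Qed.

Lemma le_outer : {homo outer : A B / A `<=` B >-> A <= B}.
Proof.
move=> A B AB; apply: le_ereal_inf_tmp => _ [V [oV BV] <-]; apply: outer_le => //.
exact: subset_trans AB BV.
Qed.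

Lemma outer_le1 E : outer E <= 1.
Proof. by apply: le_trans (outer_le openT _) (inner_le1 _). Qed.

Lemma outer_fin_num E : outer E \is a fin_num.
Proof. by rewrite ge0_fin_numE ?outer_ge0// (le_lt_trans (outer_le1 E))// ltry. Qed.

Lemma outer_set0 : outer set0 = 0.
Proof.
rewrite outer_open; last exact: open0.
apply/eqP; rewrite eq_le inner_ge0 andbT.
apply: ge_ereal_sup => _ [L [_ L0] <-].
by rewrite lee_fin -content0; exact: le_content.
Qed.

Lemma outer_approx E (d : R) : (0 < d)%R ->
  exists U, [/\ open U, E `<=` U & inner U <= outer E + d%:E].
Proof.
move=> d0; have [_ [U [oU EU] <-] /ltW] := lb_ereal_inf_adherent d0 (outer_fin_num E).
by exists U.
Qed.

Lemma outer_sigma_subadditive : sigma_subadditive outer.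
Proof.
move=> A; apply/lee_addgt0Pr => d d0.
apply: (le_trans _ (epsilon_trick _ _ (ltW d0))); last by move=> i; exact: outer_ge0.
have /choice[U UP] i : exists U, [/\ open U, A i `<=` U &
    inner U <= outer (A i) + (d / (2 ^ i.+1)%:R)%:E].
  by apply: outer_approx; rewrite divr_gt0// ltr0n expn_gt0.
apply: (@le_trans _ _ (inner (\bigcup_n U n))).
  apply: outer_le; first by apply: bigcup_open => i _; have [] := UP i.
  by move=> y [i _ Aiy]; exists i => //; have [_ + _] := UP i; apply.
apply: le_trans (inner_bigcup _) _; first by move=> i; have [] := UP i.
apply: lee_nneseries => [i _ _|i _]; first exact: inner_ge0.
by have [] := UP i.
Qed.

HB.instance Definition _ := isOuterMeasure.Build R X outer
  outer_set0 outer_ge0 le_outer outer_sigma_subadditive.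

(** For an open [V] containing [E], the part of [V] outside [U] need not be open. Approximating the
    part inside [U] by a closed [K] leaves the open set [V] minus [K], to which [inner_setD]
    applies. *)
Lemma open_caratheodory U : open U -> outer.-caratheodory U.
Proof.
move=> oU; apply: le_caratheodory_measurable => E.
apply: le_ereal_inf_tmp => _ [V [oV EV] <-].
have oVU : open (V `&` U) by exact: openI.
apply: (@le_trans _ _ (inner (V `&` U) + outer (E `&` ~` U))).
  by rewrite leeD2r// outer_le// => y [/EV].
rewrite -leeBrDr ?outer_fin_num//; apply: ge_ereal_sup => _ [K [cK KVU] <-].
rewrite leeBrDr ?outer_fin_num//.
apply: (@le_trans _ _ ((m K)%:E + inner (V `\` K))).
  rewrite leeD2l// outer_le//; first by apply: openI => //; exact: closed_openC.
  by move=> y [/EV Vy nUy]; split=> // /KVU[].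
by apply: inner_setD => // y /KVU[].
Qed.

Lemma borel_caratheodory (A : set (borel X)) : measurable A -> outer.-caratheodory A.
Proof.
apply: smallest_sub => /=; last exact: open_caratheodory.
split.
- exact: caratheodory_measurable_set0.
- by move=> B cB; rewrite setTD; exact: caratheodory_measurable_setC.
- exact: caratheodory_measurable_bigcup.
Qed.

Definition regularization (A : set (borel X)) : \bar R := outer A.

Let regularization_semi_sigma_additive : semi_sigma_additive regularization.
Proof.
move=> F mF tF mUF; apply: (@caratheodory_measure_sigma_additive _ _ outer F) => //.
- by move=> i; exact: borel_caratheodory.
- exact: borel_caratheodory.
Qed.

HB.instance Definition _ := isMeasure.Build _ _ _ regularization
  outer_set0 outer_ge0 regularization_semi_sigma_additive.

Let regularization_setT : regularization setT = 1.
Proof.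
rewrite /regularization outer_open; last exact: openT.
apply/eqP; rewrite eq_le inner_le1/= -[1]/(1%R%:E) -mT.
by apply: inner_ge => //; exact: closedT.
Qed.

HB.instance Definition _ :=
  Measure_isProbability.Build _ _ _ regularization regularization_setT.

Definition regular_bprob : bprob X := bprob_of regularization.

Lemma regular_bprobE A : measurable A -> regular_bprob A = outer A.
Proof. exact: brestrE. Qed.

(** [F] itself competes in [inner U] for every open [U] containing it. This is the direction that
    [dominates] requires. *)
Lemma content_le_regular F : closed F -> (m F <= fine (regular_bprob F))%R.
Proof.
move=> cF; have mF := closed_borel cF.
rewrite -lee_fin fine_borel// regular_bprobE//.
by apply: le_ereal_inf_tmp => _ [U [_ FU] <-]; exact: inner_ge.
Qed.

(** A closed [K] inside the preimage of [U] has a compact image inside [U], and [m K] is at most [m]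
    of the preimage of that image, which is [m] of the image. Complements give the reverse
    inequality. *)
Lemma regular_bprob_invariant (T : X -> X) : continuous T ->
  (forall A, m (T @^-1` A) = m A) -> invariant_measures T regular_bprob.
Proof.
move=> cT mTA.
have le A : outer (T @^-1` A) <= outer A.
  apply: le_ereal_inf_tmp => _ [U [oU AU] <-].
  apply: (@le_trans _ _ (inner (T @^-1` U))).
    apply: outer_le; first by move/continuousP : cT; apply.
    exact: preimage_subset.
  apply: ge_ereal_sup => _ [K [cK KU] <-].
  apply: (@le_trans _ _ (m (T @` K))%:E).
    by rewrite lee_fin -(mTA (T @` K)); apply: le_content => y Ky; exists y.
  apply: inner_ge; last by move=> _ [y Ky <-]; exact: KU.
  apply: compact_closed; first exact: metric_hausdorff.
  apply: continuous_compact; first exact: continuous_subspaceT.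
  exact: subclosed_compact cK cX _.
move=> A mA; have mTA' := borel_preimage cT mA.
apply/eqP; rewrite eq_le; apply/andP; split; first by rewrite !regular_bprobE.
have := le (~` A); rewrite preimage_setC -!regular_bprobE; last 2 first.
- exact: measurableC.
- exact: measurableC.
rewrite !probability_setC// -(fine_borel regular_bprob mA).
rewrite -(fine_borel regular_bprob mTA') -!EFinB !lee_fin; lra.
Qed.

End content_regularization.

(** * Ultrafilter limits of empirical frequencies *)

Section accumulation.
Context {R : realType} {X : pmetricType R}.
Variables (T : X -> X) (x : X).

Lemma freq01 n A : 0 <= freq T x n A <= 1.
Proof.
case: n => [|n]; first by rewrite /freq invr0 mul0r lexx ler01.
rewrite /freq mulr_ge0 ?invr_ge0 ?sumr_ge0//= ler_pdivrMl ?ltr0n// mulr1.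
have -> : n.+1%:R = \sum_(j < n.+1) (1 : R).
  by rewrite sumr_const card_ord.
by apply: ler_sum => j _; rewrite indicE lern1; case: (_ \in _).
Qed.

Lemma freqU n A B : A `&` B = set0 ->
  freq T x n (A `|` B) = freq T x n A + freq T x n B.
Proof.
move=> AB; rewrite /freq -mulrDr -big_split/=; congr (_ * _); apply: eq_bigr => j _.
rewrite !indicE in_setU.
case: (boolP (_ \in A)) => [/set_mem Aj|_]; last by rewrite add0r.
case: (boolP (_ \in B)) => [/set_mem Bj|_]; last by rewrite addr0.
by have : (A `&` B) (iter j T x) by []; rewrite AB.
Qed.

Lemma freq_preimage n A :
  `|freq T x n.+1 (T @^-1` A) - freq T x n.+1 A| <= n.+1%:R^-1.
Proof.
rewrite /freq -mulrBr -sumrB.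
rewrite (eq_bigr (fun j : 'I_n.+1 => \1_A (iter j.+1 T x) - \1_A (iter j T x) : R))//.
rewrite -(big_mkord xpredT (fun j => \1_A (iter j.+1 T x) - \1_A (iter j T x) : R)).
rewrite (telescope_sumr (fun j => \1_A (iter j T x) : R))// normrM.
rewrite [X in X * _]ger0_norm ?invr_ge0// ger_pMr ?invr_gt0 ?ltr0n//.
by rewrite !indicE; case: (_ \in A); case: (_ \in A);
  rewrite /= ?subrr ?subr0 ?sub0r ?normrN ?normr0 ?normr1.
Qed.

Hypotheses (cX : compact [set: X]) (cT : continuous T).

(** Along an ultrafilter the frequencies of all subsets of [X] converge at once, which gives an
    invariant finitely additive [m]; its regularization dominates. *)
Lemma exists_dominating : exists mu : bprob X,
  invariant_measures T mu /\ dominates T x mu.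
Proof.
have [G [ultraG ooG]] := @ultraFilterLemma nat \oo _.
have PG : ProperFilter G by exact: ultra_proper.
have /choice[m mG] A : exists l : R, freq T x n A @[n --> G] --> l.
  have [|l [_ Gl]] := @segment_compact R 0 1 (freq T x n A @[n --> G]) _.
    by apply: (@filterE _ G) => n /=; rewrite in_itv/= freq01.
  (* A cluster point along an ultrafilter is a limit: otherwise the complement of the preimage of
     [B] would belong to [G]. *)
  exists l => B Bl; have [//|GB] := in_ultra_setVsetC (freq T x ^~ A @^-1` B) ultraG.
  by have [r []] := Gl (~` B) B GB Bl.
have uniq A l : freq T x n A @[n --> G] --> l -> m A = l.
  by move=> Al; apply: (cvg_unique _ (mG A) Al); exact: norm_hausdorff.
have m0 A : 0 <= m A.
  apply: (ler_cvg_to (cvg_cst _) (mG A)); apply: nearW => n.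
  by have /andP[] := freq01 n A.
have mU A B : A `&` B = set0 -> m (A `|` B) = m A + m B.
  move=> AB; apply: uniq; under eq_fun do rewrite freqU//.
  by apply: cvgD; exact: mG.
have Gge N : G [set n | (N <= n)%N] by apply: ooG; exact: nbhs_infty_ge.
have mT : m setT = 1.
  apply: uniq; apply: cvg_near_cst; apply: filterS (Gge 1%N) => n /= n0.
  rewrite /freq; under eq_bigr do rewrite indicT.
  by rewrite sumr_const card_ord mulVf// pnatr_eq0 -lt0n.
have mTA A : m (T @^-1` A) = m A.
  apply/eqP; rewrite -subr_eq0 -normr_le0; apply/ler_addgt0Pr => e e0; rewrite add0r.
  have cvgTA : `|freq T x n (T @^-1` A) - freq T x n A| @[n --> G] -->
      `|m (T @^-1` A) - m A|.
    by apply: cvg_norm; apply: cvgB; exact: mG.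
  apply: (ler_cvg_to cvgTA (cvg_cst e)).
  have [N _ Ne] := near_infty_natSinv_lt (PosNum e0).
  apply: filterS (Gge N.+1) => -[//|n] /= Nn.
  by apply: le_trans (freq_preimage _ _) _; apply/ltW/Ne.
exists (regular_bprob cX m0 mU mT); split; first exact: regular_bprob_invariant.
move=> I F cF d d0 N.
have : \forall n \near G, forall i, freq T x n (F i) <= m (F i) + d.
  apply: filter_forall => i; apply: (cvgr_le _ (mG (F i))).
  by rewrite ltrDl.
move=> /(filterI (Gge N.+1))/filter_ex[n [Nn nF]].
exists n; split=> [||i]; [exact: ltnW|exact: leq_ltn_trans Nn|].
apply: le_trans (nF i) _; rewrite lerD2r.
exact: content_le_regular.
Qed.

End accumulation.

(** * Mixtures and level sets *)

Section mixtures.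
Context {R : realType} {X : pmetricType R}.
Implicit Types (mu nu : bprob X) (t : {i01 R}).

Lemma mixE t mu nu (A : set (borel X)) : measurable A ->
  mix t mu nu A = (t%:num%:E * mu A + (1 - t%:num)%:E * nu A)%E.
Proof.
move=> mA; transitivity (mix_fun t mu nu A); first exact: brestrE.
by rewrite /mix_fun measure_addE.
Qed.

Lemma fine_mix t mu nu (A : set (borel X)) : measurable A ->
  fine (mix t mu nu A) = t%:num * fine (mu A) + (1 - t%:num) * fine (nu A).
Proof.
move=> mA; apply: EFin_inj.
by rewrite fine_borel// mixE// [RHS]EFinD !EFinM !fine_borel.
Qed.

Lemma mix_invariant T t mu nu : continuous T -> invariant_measures T mu ->
  invariant_measures T nu -> invariant_measures T (mix t mu nu).
Proof.
move=> cT imu inu A mA; rewrite !mixE//; last exact: borel_preimage.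
by rewrite imu// inu.
Qed.

Lemma Rintegral_mix01 t mu nu (f : X -> R) : continuous f ->
  (forall y, 0 <= f y <= 1) ->
  \int[mix t mu nu]_y f y =
    t%:num * \int[mu]_y f y + (1 - t%:num) * \int[nu]_y f y.
Proof.
move=> cf f01; have f0 y : 0 <= f y by have /andP[] := f01 y.
have fE0 (y : borel X) : [set: borel X] y -> (0%R <= (f y)%:E)%E by rewrite lee_fin.
have mf : measurable_fun [set: borel X] (EFin \o (f : borel X -> R)).
  by apply/measurable_EFinP; exact: continuous_borel_fun.
have fI (m : probability (borel X) R) : (\int[m]_y (f y)%:E \is a fin_num)%E.
  by apply: integrable_fin_num => //; exact: continuous_integrable.
rewrite /Rintegral (@eq_measure_integral _ _ _ setT (mix_fun t mu nu)); last first.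
  by move=> A mA _; exact: brestrE.
apply: EFin_inj; rewrite [RHS]EFinD !EFinM !fineK; do ?exact: fI.
rewrite ge0_integral_measure_add//; congr (_ + _)%E; exact: ge0_integral_mscale.
Qed.

Lemma Rintegral_mix t mu nu (f : X -> R) : compact [set: X] -> continuous f ->
  \int[mix t mu nu]_y f y =
    t%:num * \int[mu]_y f y + (1 - t%:num) * \int[nu]_y f y.
Proof.
move=> cX cf.
have [M M0 fM] : exists2 M, 0 < M & forall y, `|f y| <= M.
  have /compact_bounded[M [_ fM]] : compact (f @` [set: X]).
    by apply: continuous_compact cX; exact: continuous_subspaceT.
  exists (`|M| + 1) => [|y]; first by rewrite ltr_wpDl.
  by apply: (fM (`|M| + 1)); [rewrite ltr_pwDr// ler_norm|exists y].
(* Affine rescaling of a bounded [f] into [[0, 1]], where the integrals are those of nonnegative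
   functions. *)
pose g y := (f y + M) / (2 * M).
have M20 : 0 < 2 * M by rewrite mulr_gt0.
have cg : continuous g.
  by move=> y; apply: cvgMl; apply: cvgD; [exact: cf|exact: cvg_cst].
have g01 y : 0 <= g y <= 1.
  have := fM y; rewrite ler_norml => /andP[fM1 fM2].
  rewrite /g divr_ge0 ?(ltW M20) ?ler_pdivrMr//; lra.
have fE (m : probability (borel X) R) : \int[m]_y f y = 2 * M * \int[m]_y g y - M.
  have gI := continuous_integrable m cg g01.
  rewrite -RintegralZl// -[X in _ - X]mulr1 -[X in M * X]/(fine 1%E).
  rewrite -(probability_setT m) -Rintegral_cst// -RintegralB//=.
  - by apply: eq_Rintegral => y _; rewrite /g mulrC divfK ?gt_eqF// addrK.
  - exact: (integrableZl _ _ gI).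
  - exact: finite_measure_integrable_cst.
by rewrite !fE Rintegral_mix01//; ring.
Qed.

(** Stated for one partition, so that the left side stays a real number even if [mu] has infinite
    entropy. *)
Lemma metric_entropy_mix T t mu nu k (p : X -> 'I_k) : continuous T ->
  invariant_measures T mu -> invariant_measures T nu -> 0 < t%:num ->
  (forall i, measurable (p @^-1` [set i] : set (borel X))) ->
  ((t%:num * limn (fun n => entropy (word_prob T p mu (n := n)) / n%:R))%:E <=
   metric_entropy T (mix t mu nu))%E.
Proof.
move=> cT imu inu t0 mp; apply: le_trans (le_metric_entropy _ _ mp); rewrite lee_fin.
have imix := mix_invariant t cT imu inu.
have cmu := word_entropy_cvg cT mp imu.
have wE n : word_prob T p (mix t mu nu) (n := n) = fun w =>
    t%:num * word_prob T p mu w + (1 - t%:num) * word_prob T p nu w.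
  by apply/funext => w; rewrite /word_prob fine_mix//; exact: itin_measurable.
apply: (ler_cvg_to (cvgM (cvg_cst t%:num) cmu) (word_entropy_cvg cT mp imix)).
apply: nearW => n /=; rewrite wE mulrA ler_wpM2r ?invr_ge0//.
apply: entropy_mix; rewrite ?t0//=; try exact: word_prob_ge0; exact: sum_word_prob.
Qed.

Lemma clamp01_subproof (s : R) : 0 <= Num.max 0 (Num.min 1 s) <= 1.
Proof. by rewrite le_max lexx/= ge_max ler01/= ge_min lexx. Qed.

(** Extends the parameter of a mixture to all of [R], so that segments of mixtures are images of
    real intervals under a globally defined continuous map. *)
Definition clamp01 (s : R) : {i01 R} :=
  Itv01 (proj1 (andP (clamp01_subproof s))) (proj2 (andP (clamp01_subproof s))).

Lemma clamp01E s : 0 <= s <= 1 -> (clamp01 s)%:num = s.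
Proof. by move=> /andP[s0 s1]; rewrite /= min_r// max_r. Qed.

Lemma clamp01_continuous : continuous (fun s : R => (clamp01 s)%:num).
Proof.
move=> s; apply: (@continuous_max R R (cst 0) (Num.min 1)); first exact: cvg_cst.
apply: (@continuous_min R R (cst 1) id); [exact: cvg_cst|exact: cvg_id].
Qed.

Lemma mix_continuous mu nu : compact [set: X] ->
  continuous (fun s : R => mix (clamp01 s) mu nu).
Proof.
move=> cX; apply: (@continuous_comp_initial _ _ _ (@wstar_eval R X)) => s.
apply/cvg_sup => f.
have surj (B : set R) :
    [set g f | g in [set g : continuousType X R -> R | B (g f)]] = B.
  by apply/seteqP; split=> [_ [g Bg <-//]|r Br]; exists (fun=> r).
apply/cvg_image => [|B Bs].
  by apply/seteqP; split=> // r _; exists (fun=> r).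
exists [set g | B (g f)]; last exact: surj.
have cf : continuous (fun s : R => \int[mix (clamp01 s) mu nu]_y f y).
  under eq_fun do rewrite (Rintegral_mix _ _ _ cX (@cts_fun _ _ f)).
  move=> r; apply: cvgD; (apply: cvgM; last exact: cvg_cst).
    exact: clamp01_continuous.
  by apply: cvgB; [exact: cvg_cst|exact: clamp01_continuous].
exact: (cf s B Bs).
Qed.

End mixtures.

(** * Entropy of the level sets of [alpha] *)

Section level_sets.
Context {R : realType} {X : pmetricType R}.
Variables (T : X -> X) (alpha : bprob X -> R).
Local Open Scope ereal_scope.

Lemma image_not_constant (M : set (bprob X)) :
  ereal_inf [set (alpha mu)%:E | mu in M] < ereal_sup [set (alpha mu)%:E | mu in M] <->
  exists mu nu, [/\ M mu, M nu & alpha mu <> alpha nu].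
Proof.
split=> [lt|[mu [nu [Mmu Mnu neq]]]].
  apply: contrapT => H; move: lt; apply/negP; rewrite -leNgt.
  have eqa mu nu : M mu -> M nu -> alpha mu = alpha nu.
    by move=> Mmu Mnu; apply: contrapT => neq; apply: H; exists mu, nu.
  apply: ge_ereal_sup => _ [mu Mmu <-]; apply: le_ereal_inf_tmp => _ [nu Mnu <-].
  by rewrite lee_fin (eqa mu nu).
have in_image x : M x -> [set (alpha mu)%:E | mu in M] (alpha x)%:E by exists x.
wlog lt : mu nu Mmu Mnu neq / (alpha mu < alpha nu)%R.
  move=> W; have [lt|lt|//] := ltgtP (alpha mu) (alpha nu); first exact: (W mu nu).
  by apply: (W nu mu) => // /esym.
apply: (@le_lt_trans _ _ (alpha mu)%:E); first exact/ereal_inf_lbound/in_image.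
apply: (@lt_le_trans _ _ (alpha nu)%:E); first by rewrite lte_fin.
exact/ereal_sup_ubound/in_image.
Qed.

Hypotheses (cX : compact [set: X]) (cT : continuous T).

(** Saturation is applied to the segment [K] of mixtures with weight in [[theta, 1]] on [mu]; then
    one partition entropy [L] of [mu] is approached by letting [theta] tend to 1. *)
Lemma metric_entropy_le_htop_I mu nu : transitively_convex_saturated T ->
  condA3 T alpha -> invariant_measures T mu -> invariant_measures T nu ->
  alpha mu <> alpha nu -> metric_entropy T mu <= htop T (I_alpha T alpha `&` Tran T).
Proof.
move=> sat A3 imu inu neq; apply: metric_entropy_le => k p mp.
set L := limn _; set H := htop _ _.
have L0 : (0 <= L)%R.
  apply: limr_ge; first exact: word_entropy_cvg.
  by apply: nearW => n; rewrite divr_ge0// entropy_ge0// => w; exact: word_prob01.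
suff thetaL (theta : R) : (0 < theta < 1)%R -> (theta * L)%:E <= H.
  (* Chosen so that [theta * L + d >= L], since [L / (L + d + 1) <= 1]; the added 1 keeps [theta]
     positive. *)
  apply/lee_addgt0Pr => d d0; pose theta : R := (1 - d / (L + d + 1))%R.
  have Ld : (0 < L + d + 1)%R by rewrite ltr_wpDl// addr_ge0// ltW.
  have th : (0 < theta < 1)%R.
    rewrite /theta subr_gt0 ltr_pdivrMr// mul1r gtrBl divr_gt0//; lra.
  apply: le_trans (leeD2r d%:E (thetaL theta th)).
  rewrite -EFinD lee_fin /theta mulrBl mul1r -addrA lerDl addrC subr_ge0.
  rewrite mulrAC ler_pdivrMr// ler_pM2l//; lra.
move=> /andP[th0 th1].
pose g (s : R) := mix (clamp01 s) mu nu.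
pose K := g @` `[theta, 1%R].
have cg : {within `[theta, 1%R], continuous g}.
  by apply: continuous_subspaceT; exact: mix_continuous.
have Kinv : K `<=` invariant_measures T by move=> _ [s _ <-]; exact: mix_invariant.
have gE (t : {i01 R}) : g t%:num = mix t mu nu.
  by rewrite /g; congr mix; apply: val_inj; rewrite /= -[RHS]clamp01E//; apply/andP.
have Kt (t : {i01 R}) : (theta <= t%:num)%R -> K (mix t mu nu).
  by move=> tht; exists t%:num => //=; rewrite in_itv/= tht /=.
have K1 : K (mix (1%:i01)%R mu nu) by apply: Kt => /=; exact: ltW.
have [[] _ _ satK] : saturated_at T K.
  apply: sat => //.
  - by exists (mix (1%:i01)%R mu nu).
  - by apply: continuous_compact => //; exact: segment_compact.
  - by apply: connected_continuous_connected => //; exact: segment_connected.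
  - exists 2%N, (fun i : 'I_2 => if i == ord0 then mu else nu); split.
      by move=> i; case: ifP.
    move=> _ [s _ <-].
    exists (fun i : 'I_2 => if i == ord0 then (clamp01 s)%:num
                            else 1 - (clamp01 s)%:num)%R.
    split.
    + by move=> i; case: ifP => // _; rewrite subr_ge0.
    + by rewrite !big_ord_recl big_ord0/= addr0 addrC subrK.
    + by move=> A mA; rewrite mixE// !big_ord_recl big_ord0/= adde0.
apply: (@le_trans _ _ (htop T (GK T K))).
  rewrite satK; apply: le_ereal_inf_tmp => _ [_ [s ths <-] <-].
  move: ths; rewrite /= in_itv/= => /andP[ths s1].
  have s0 : (0 < s)%R by exact: lt_le_trans ths.
  have cs : (clamp01 s)%:num = s by apply: clamp01E; rewrite s1 ltW.
  apply: le_trans (metric_entropy_mix cT imu inu _ mp); last by rewrite cs.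
  by rewrite cs lee_fin ler_wpM2r.
apply: htop_le => y [Ty yK]; split=> //.
(* As [Mlim T y] is [K], membership in [I_alpha] says that [alpha] is not constant on [K]; this is
   [A.3] on [[theta, 1]]. *)
apply/image_not_constant; rewrite yK.
have J01 : `[theta, 1%R]%classic `<=` `[0%R, 1%R].
  by move=> s /=; rewrite !in_itv/= => /andP[/(le_trans (ltW th0)) -> ->].
apply: contrapT => H0.
have iJ : is_interval `[theta, 1%R]%classic by exact: interval_is_interval.
case: (A3 mu nu imu inu neq _ iJ J01).
  by exists theta, 1%R; split=> //=; rewrite in_itv/= ?lexx ltW.
exists (alpha (mix (1%:i01)%R mu nu)) => t /=; rewrite in_itv/= => /andP[tht _].
by apply: contrapT => neqt; apply: H0; exists (mix t mu nu), (mix (1%:i01)%R mu nu);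
  split=> //; exact: Kt.
Qed.

(** A point of [I_alpha] yields [mu] and [nu] with different values of [alpha]. Any invariant [rho]
    differs in [alpha] from one of them, so the segment argument bounds the entropy of every
    invariant measure by [H]. *)
Lemma htop_I_alpha : transitively_convex_saturated T -> condA3 T alpha ->
  I_alpha T alpha = set0 \/
  htop T (I_alpha T alpha `&` Tran T) = htop T (I_alpha T alpha) /\
  htop T (I_alpha T alpha) = htop T setT.
Proof.
move=> sat A3; have [[x Ix]|I0] := pselect (I_alpha T alpha !=set0); last first.
  by left; apply/seteqP; split=> // x Ix; apply: I0; exists x.
right; have [mu [nu [Mmu Mnu neq]]] := (image_not_constant (Mlim T x)).1 Ix.
have imu := Mlim_invariant cT Mmu; have inu := Mlim_invariant cT Mnu.
pose H := htop T (I_alpha T alpha `&` Tran T).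
have entH rho : invariant_measures T rho -> metric_entropy T rho <= H.
  move=> irho; have [eqm|neqm] := eqVneq (alpha rho) (alpha mu).
    by apply: (@metric_entropy_le_htop_I rho nu) => //; rewrite eqm.
  by apply: (@metric_entropy_le_htop_I rho mu) => //; exact/eqP.
have IH : H <= htop T (I_alpha T alpha) by apply: htop_le => y [].
have IT : htop T (I_alpha T alpha) <= htop T setT by exact: htop_le.
have TH : htop T setT <= H.
  apply: (htop_le_entropy cT cX).
    exact: le_trans (metric_entropy_ge0 cT imu) (entH _ imu).
  move=> y _; have [rho [irho drho]] := exists_dominating y cX cT.
  by exists rho; split; [exact: irho|exact: drho|exact: entH].
split; apply/le_anti/andP; split.
- exact: IH.
- exact: (le_trans IT TH).
- exact: IT.
- exact: (le_trans TH IH).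
Qed.

Lemma htop_R_alpha a : transitively_single_saturated T ->
  R_alpha T alpha a = set0 \/
  htop T (R_alpha T alpha a `&` Tran T) = htop T (R_alpha T alpha a) /\
  htop T (R_alpha T alpha a) = ereal_sup [set metric_entropy T rho |
    rho in [set rho | invariant_measures T rho /\ alpha rho = a]].
Proof.
move=> sat; have [[x Rx]|R0] := pselect (R_alpha T alpha a !=set0); last first.
  by left; apply/seteqP; split=> // x Rx; apply: R0; exists x.
right; set S := ereal_sup _.
have Rmu y : R_alpha T alpha a y -> exists mu,
    [/\ Mlim T y mu, invariant_measures T mu & alpha mu = a].
  (* An empty [Mlim T y] is impossible: its infimum would be infinite instead of [a]. *)
  move=> [infa supa]; have [[mu Mmu]|M0] := pselect (Mlim T y !=set0); last first.
    move: infa; rewrite (_ : Mlim T y = set0) ?image_set0 ?ereal_inf0//.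
    by apply/seteqP; split=> // mu Mmu; apply: M0; exists mu.
  exists mu; split=> //; first exact: Mlim_invariant Mmu.
  have amu : [set (alpha mu)%:E | mu in Mlim T y] (alpha mu)%:E by exists mu.
  apply/eqP; rewrite eq_le -2!lee_fin; apply/andP; split.
    by rewrite -supa; exact: ereal_sup_ubound.
  by rewrite -infa; exact: ereal_inf_lbound.
have leS rho : invariant_measures T rho -> alpha rho = a -> metric_entropy T rho <= S.
  by move=> irho arho; apply: ereal_sup_ubound; exists rho.
have RS : htop T (R_alpha T alpha a) <= S.
  apply: (htop_le_entropy cT cX).
    have [mu [_ imu amu]] := Rmu x Rx.
    exact: le_trans (metric_entropy_ge0 cT imu) (leS _ imu amu).
  move=> y /Rmu[mu [Mmu imu amu]]; exists mu.
  by split; [exact: imu|exact: Mlim_dominates|exact: leS].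
have SR : S <= htop T (R_alpha T alpha a `&` Tran T).
  apply: ge_ereal_sup => _ [rho [irho arho] <-].
  have [_ satrho] := sat rho irho.
  have <- : ereal_inf [set metric_entropy T mu | mu in [set rho]] =
      metric_entropy T rho.
    by rewrite image_set1 ereal_inf1.
  rewrite -satrho; apply: htop_le => y [Ty yrho]; split=> //.
  by rewrite /R_alpha /= yrho image_set1 ereal_inf1 ereal_sup1 arho.
have IR : htop T (R_alpha T alpha a `&` Tran T) <= htop T (R_alpha T alpha a).
  by apply: htop_le => y [].
split; apply/le_anti/andP; split.
- exact: IR.
- exact: (le_trans RS SR).
- exact: RS.
- exact: (le_trans SR IR).
Qed.

End level_sets.

(* alpha is a function on invariant measures: its values elsewhere play no role. *)
Theorem theorem1p6 (R : realType) (X : pmetricType R) (T : X -> X)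
    (alpha : bprob X -> R) :
  compact [set: X] -> continuous T ->
  {within invariant_measures T, continuous alpha} ->
  (transitively_convex_saturated T -> condA3 T alpha ->
     I_alpha T alpha = set0 \/
     (htop T (I_alpha T alpha `&` Tran T) = htop T (I_alpha T alpha) /\
      htop T (I_alpha T alpha) = htop T setT)) /\
  (transitively_single_saturated T ->
     forall a : R,
     R_alpha T alpha a = set0 \/
     (htop T (R_alpha T alpha a `&` Tran T) = htop T (R_alpha T alpha a) /\
      htop T (R_alpha T alpha a) =
        ereal_sup [set metric_entropy T rho |
                   rho in [set rho | invariant_measures T rho /\
                                     alpha rho = a]])).
Proof.
move=> cX cT _; split=> [|sat a]; first exact: htop_I_alpha.
exact: htop_R_alpha.
Qed.
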